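(* Let $\phi:\mathbb{R}\to\mathbb{C}$ be Riemann's non-differentiable function \[ \phi(t) = \sum_{k \in \mathbb{Z}} \frac{ e^{-4\pi^2 i k^2 t} - 1 }{-4\pi^2 k^2}, \qquad t \in \mathbb{R}. \] Then the Hausdorff dimension of its image, regarded as a subset of $\mathbb{C}\cong\mathbb{R}^2$, satisfies \[ 1 \leq \dim_{\mathcal{H}}\phi(\mathbb{R}) \leq \frac43. \]
   Context: In the series defining $\phi$, the term with $k=0$ is interpreted as its limit value $\lim_{k\to 0}\frac{e^{-4\pi^2 i k^2 t}-1}{-4\pi^2k^2} = it$. The series converges absolutely and uniformly on compact sets, so $\phi$ is continuous. $\dim_{\mathcal{H}}$ denotes Hausdorff dimension. *)

(* Defs.v *)
From Stdlib Require Import Reals ZArith.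
Open Scope R_scope.

Definition pt := (R * R)%type.

Definition dist2 (p q : pt) : R :=
  sqrt ((fst p - fst q)^2 + (snd p - snd q)^2).

(* r^s with the convention 0^s = 0 (diam of empty set / weights) *)
Definition wpow (r s : R) : R :=
  if Rle_dec r 0 then 0 else Rpower r s.

(* H^s(A) = 0 : for every delta > 0 and eps > 0 there is a countable cover
   (U n) of A by sets of diameter <= r n <= delta with sum (r n)^s <= eps.
   (Bounding diam U_n by r_n is equivalent to using diam U_n itself, since
    r_n := diam U_n is allowed.) *)
Definition H_null (s : R) (A : pt -> Prop) : Prop :=
  forall delta eps : R, 0 < delta -> 0 < eps ->
    exists (U : nat -> pt -> Prop) (r : nat -> R),
      (forall x, A x -> exists n, U n x) /\
      (forall n, 0 <= r n <= delta) /\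
      (forall n x y, U n x -> U n y -> dist2 x y <= r n) /\
      (forall N, sum_f_R0 (fun n => wpow (r n) s) N <= eps).

Definition is_hausdorff_dim (A : pt -> Prop) (d : R) : Prop :=
  (forall s, 0 <= s -> H_null s A -> d <= s) /\
  (forall b, (forall s, 0 <= s -> H_null s A -> b <= s) -> b <= d).

(* k-th term of Riemann's function, theta = 4 pi^2 k^2 t:
   (e^{-i theta} - 1)/(-4 pi^2 k^2) = ((cos theta - 1) - i sin theta)/(-4 pi^2 k^2);
   the k = 0 term is its limit i t. *)
Definition rterm_re (k : Z) (t : R) : R :=
  if Z.eq_dec k 0 then 0
  else (cos (4 * PI^2 * (IZR k)^2 * t) - 1) / (- 4 * PI^2 * (IZR k)^2).

Definition rterm_im (k : Z) (t : R) : R :=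
  if Z.eq_dec k 0 then t
  else (- sin (4 * PI^2 * (IZR k)^2 * t)) / (- 4 * PI^2 * (IZR k)^2).

Definition psum (f : Z -> R -> R) (t : R) (N : nat) : R :=
  sum_f_R0 (fun n => f (Z.of_nat n - Z.of_nat N)%Z t) (2 * N).

Definition phi_val (t : R) (p : pt) : Prop :=
  Un_cv (psum rterm_re t) (fst p) /\ Un_cv (psum rterm_im t) (snd p).

Definition phi_image (p : pt) : Prop := exists t : R, phi_val t p.

(* Main.v *)
Require Import Defs.
From Stdlib Require Import Reals.
From Stdlib Require Import ZArith Znumtheory List Permutation Lia Lra ClassicalEpsilon.
From Stdlib Require Cantor.
Import ListNotations.
Open Scope R_scope.

(** With [x = 2 PI t], the derivative in [x] of a partial sum of the series is a
    quadratic exponential sum [sum_(|k| < K) e(k^2 x)], and Abel summation bounds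
    the tails by the same exponential sums.  Weyl's inequality controls them by
    [N sqrt (log q / q)] for [N >= q] when [|x - p/q| <= 1/q^2].  Cutting the series
    at [K ~ sqrt (q Q)], the image of the interval [|x - p/q| <= 1/(q Q)] has
    diameter [O (sqrt (log Q) / (q sqrt Q))].  By Dirichlet's theorem the intervals
    with [q <= Q] cover the line, there are [O(q)] of them per unit length for each
    [q], and [sum_(q <= Q) q (q sqrt Q)^(-s)] is of order [Q^(2 - 3s/2)], which
    beats the logarithms exactly when [s > 4/3].
    For the lower bound, the real part is continuous and not constant, so the
    image projects onto a set containing an interval. *)

(** Weyl's inequality loses a logarithm against the true size [N / sqrt q] of the sums at [p/q], but
    the dimension is an infimum, so exponents arbitrarily close to [4/3] suffice and no asymptotic
    formula for phi near rationals is needed. The inequality requires length at least [q]; this is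
    compatible with the optimal cut because [sqrt (q Q) >= q], and the same bound then controls both
    the derivative of the head and the tail. All estimates are made on partial sums, uniformly in
    their length, and pass to whatever limits exist, so convergence of the series enters only in the
    lower bound. Each cover uses a single large [Q] and is finite over a bounded range of [t]; the
    whole line is a countable union of such ranges. *)

Lemma Rabs_le_inv a b : Rabs a <= b -> - b <= a <= b.
Proof. unfold Rabs; destruct (Rcase_abs a); lra. Qed.

(** * Finite sums over lists *)

Fixpoint lsum {A : Type} (f : A -> R) (l : list A) : R :=
  match l with
  | [] => 0
  | a :: l' => f a + lsum f l'
  end.

Lemma lsum_app {A : Type} (f : A -> R) l l' :
  lsum f (l ++ l') = lsum f l + lsum f l'.
Proof. induction l as [|a l IH]; simpl; [|rewrite IH]; ring. Qed.

Lemma lsum_seq_S (f : nat -> R) a n :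
  lsum f (seq a (S n)) = lsum f (seq a n) + f (a + n)%nat.
Proof. rewrite seq_S, lsum_app; simpl; ring. Qed.

Lemma lsum_ext {A : Type} (f g : A -> R) l :
  (forall a, In a l -> f a = g a) -> lsum f l = lsum g l.
Proof.
induction l as [|a l IH]; simpl; intros H; [easy|].
rewrite H, IH; auto.
Qed.

Lemma lsum_le {A : Type} (f g : A -> R) l :
  (forall a, In a l -> f a <= g a) -> lsum f l <= lsum g l.
Proof.
induction l as [|a l IH]; simpl; intros H; [lra|].
apply Rplus_le_compat; auto.
Qed.

Lemma lsum_ge0 {A : Type} (f : A -> R) l :
  (forall a, In a l -> 0 <= f a) -> 0 <= lsum f l.
Proof.
induction l as [|a l IH]; simpl; intros H; [lra|].
apply Rplus_le_le_0_compat; auto.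
Qed.

Lemma lsum_plus {A : Type} (f g : A -> R) l :
  lsum (fun a => f a + g a) l = lsum f l + lsum g l.
Proof. induction l as [|a l IH]; simpl; [|rewrite IH]; ring. Qed.

Lemma lsum_scal {A : Type} c (f : A -> R) l :
  lsum (fun a => c * f a) l = c * lsum f l.
Proof. induction l as [|a l IH]; simpl; [|rewrite IH]; ring. Qed.

Lemma lsum_const {A : Type} c (l : list A) :
  lsum (fun _ => c) l = INR (length l) * c.
Proof.
induction l as [|a l IH]; [simpl; ring|].
simpl length; rewrite S_INR; simpl; rewrite IH; ring.
Qed.

Lemma lsum_map {A B : Type} (h : A -> B) (f : B -> R) l :
  lsum f (map h l) = lsum (fun a => f (h a)) l.
Proof. induction l as [|a l IH]; simpl; [|rewrite IH]; ring. Qed.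

Lemma lsum_flat_map {A B : Type} (h : A -> list B) (f : B -> R) l :
  lsum f (flat_map h l) = lsum (fun a => lsum f (h a)) l.
Proof. induction l as [|a l IH]; simpl; [ring|]. now rewrite lsum_app, IH. Qed.

Lemma lsum_Rabs {A : Type} (f : A -> R) l :
  Rabs (lsum f l) <= lsum (fun a => Rabs (f a)) l.
Proof.
induction l as [|a l IH]; simpl; [rewrite Rabs_R0; lra|].
eapply Rle_trans; [apply Rabs_triang|]; lra.
Qed.

Lemma lsum_permutation {A : Type} (f : A -> R) l l' :
  Permutation l l' -> lsum f l = lsum f l'.
Proof. induction 1; simpl; lra. Qed.

(** Together with [NoDup_map_inj_on] this bounds a sum reindexed by an injective map by the sum over
    the whole target, as in [weyl_block_bound] and [H_null_countable_union]. *)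
Lemma lsum_incl {A : Type} (f : A -> R) l l' :
  NoDup l -> incl l l' -> (forall a, In a l' -> 0 <= f a) ->
  lsum f l <= lsum f l'.
Proof.
revert l'; induction l as [|a l IH]; intros l' Hnd Hin Hf; simpl.
{ now apply lsum_ge0. }
inversion_clear Hnd as [|? ? Ha Hl].
destruct (in_split a l') as [l1 [l2 E]]; [apply Hin; now left|].
assert (P : Permutation l' (a :: l1 ++ l2))
  by (rewrite E; symmetry; apply Permutation_middle).
rewrite (lsum_permutation f _ _ P); simpl.
apply Rplus_le_compat_l, IH; auto.
- intros b Hb.
  assert (Hb' : In b (a :: l1 ++ l2))
    by (apply (Permutation_in _ P), Hin; now right).
  destruct Hb' as [->|]; [contradiction|assumption].
- intros b Hb; apply Hf, (Permutation_in _ (Permutation_sym P)); now right.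
Qed.

Lemma lsum_seq_rev (f : nat -> R) N :
  lsum (fun d => f (N - d)%nat) (seq 1 N) = lsum f (seq 0 N).
Proof.
induction N as [|N IH]; [reflexivity|].
rewrite (lsum_seq_S f 0), <- IH, Rplus_comm.
change (seq 1 (S N)) with (1%nat :: seq 2 N); simpl lsum.
rewrite <- seq_shift, lsum_map.
f_equal; f_equal; lia.
Qed.

Lemma lsum_seq_rev0 (f : nat -> R) N :
  lsum (fun i => f (N - 1 - i)%nat) (seq 0 N) = lsum f (seq 0 N).
Proof.
rewrite <- (lsum_seq_rev f N), <- seq_shift, lsum_map.
apply lsum_ext; intros i _; f_equal; lia.
Qed.

Lemma NoDup_map_inj_on {A B : Type} (f : A -> B) l :
  NoDup l -> (forall a b, In a l -> In b l -> f a = f b -> a = b) ->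
  NoDup (map f l).
Proof.
induction 1 as [|a l Ha Hl IH]; simpl; intros Hf; constructor.
- intros H; apply in_map_iff in H as [b [E Hb]].
  apply Ha; rewrite (Hf a b); auto.
- apply IH; auto.
Qed.

(** * Harmonic numbers, the source of the logarithmic factors *)

Definition harmonic (n : nat) : R := lsum (fun i => / INR i) (seq 1 n).

Lemma harmonic_ge0 n : 0 <= harmonic n.
Proof.
apply lsum_ge0; intros i Hi; apply in_seq in Hi.
apply Rlt_le, Rinv_0_lt_compat, lt_0_INR; lia.
Qed.

Lemma harmonic_incr m n : (m <= n)%nat -> harmonic m <= harmonic n.
Proof.
intros H; apply lsum_incl; [apply seq_NoDup| |].
- intros i Hi; apply in_seq in Hi; apply in_seq; lia.
- intros i Hi; apply in_seq in Hi.
  apply Rlt_le, Rinv_0_lt_compat, lt_0_INR; lia.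
Qed.

Lemma harmonic_ge1 n : (1 <= n)%nat -> 1 <= harmonic n.
Proof.
intros H; apply Rle_trans with (2 := harmonic_incr 1 n H).
unfold harmonic; simpl; lra.
Qed.

(** * Binning of fractional parts and Dirichlet approximation *)

(* [bin m u] is the index of the interval [[i/m, (i+1)/m)] containing the
   fractional part of [u]. *)
Definition bin (m : nat) (u : R) : nat :=
  Z.to_nat (Int_part (INR m * frac_part u)).

Lemma bin_spec m u : (1 <= m)%nat ->
  (bin m u < m)%nat /\
  INR (bin m u) <= INR m * frac_part u < INR (bin m u) + 1.
Proof.
intros Hm; unfold bin.
pose proof (base_fp u) as [F0 F1].
assert (M : 1 <= INR m) by (change 1 with (INR 1); now apply le_INR).
destruct (base_Int_part (INR m * frac_part u)) as [I1 I2].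
set (k := Int_part _) in *.
assert (0 <= INR m * frac_part u < INR m) by (split; nra).
assert (0 <= k)%Z by (apply Z.lt_succ_r, lt_IZR; rewrite succ_IZR; simpl; lra).
assert (k < Z.of_nat m)%Z by (apply lt_IZR; rewrite <- INR_IZR_INZ; lra).
split; [lia|].
rewrite INR_IZR_INZ, Z2Nat.id by assumption; lra.
Qed.

Lemma bin_eq m u v : (1 <= m)%nat -> bin m u = bin m v ->
  exists z : Z, Rabs (u - v - IZR z) < / INR m.
Proof.
intros Hm E.
destruct (bin_spec m u Hm) as [_ Hu]; destruct (bin_spec m v Hm) as [_ Hv].
rewrite E in Hu.
exists (Int_part u - Int_part v)%Z.
assert (M : 1 <= INR m) by (change 1 with (INR 1); now apply le_INR).
replace (u - v - IZR (Int_part u - Int_part v)) with (frac_part u - frac_part v)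
  by (rewrite minus_IZR; unfold frac_part; ring).
apply Rmult_lt_reg_l with (INR m); [lra|].
rewrite Rinv_r by lra.
rewrite <- (Rabs_pos_eq (INR m)) at 1 by lra.
rewrite <- Rabs_mult; apply Rabs_def1; lra.
Qed.

Lemma pigeonhole_bin (u : nat -> R) m : (1 <= m)%nat ->
  exists i j : nat, (i < j <= m)%nat /\ bin m (u i) = bin m (u j).
Proof.
intros Hm; apply NNPP; intros H.
assert (Hnd : NoDup (map (fun i => bin m (u i)) (seq 0 (S m)))).
{ apply NoDup_map_inj_on; [apply seq_NoDup|].
  intros i j Hi Hj E; apply in_seq in Hi; apply in_seq in Hj.
  destruct (Nat.lt_total i j) as [L|[L|L]]; [exfalso|exact L|exfalso];
    apply H; [exists i, j|exists j, i]; (split; [lia|auto]). }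
assert (Hincl : incl (map (fun i => bin m (u i)) (seq 0 (S m))) (seq 0 m)).
{ intros b Hb; apply in_map_iff in Hb as [i [<- _]].
  apply in_seq; destruct (bin_spec m (u i) Hm); lia. }
apply (NoDup_incl_length Hnd) in Hincl.
rewrite length_map, !length_seq in Hincl; lia.
Qed.

Lemma dirichlet_approximation (x : R) (Q : nat) : (1 <= Q)%nat ->
  exists (p : Z) (q : nat), (1 <= q <= Q)%nat /\ rel_prime p (Z.of_nat q) /\
    Rabs (x - IZR p / INR q) <= / (INR q * INR Q).
Proof.
intros HQ.
destruct (pigeonhole_bin (fun i => INR i * x) Q HQ) as [i [j [Hij E]]].
destruct (bin_eq _ _ _ HQ (eq_sym E)) as [z Hz].
assert (Q0 : 0 < INR Q) by (apply lt_0_INR; lia).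
set (n := (j - i)%nat).
assert (Hn : INR j * x - INR i * x = INR n * x) by (unfold n; rewrite minus_INR by lia; ring).
rewrite Hn in Hz.
(* The pigeonhole gives [|n x - z| < 1/Q] with [n <= Q], not necessarily in lowest terms. Dividing
   by the gcd only improves it: [|q x - p| = |n x - z| / g]. *)
set (g := Z.gcd z (Z.of_nat n)).
assert (Hg : (0 < g)%Z).
{ assert (g <> 0)%Z by (intros G; apply Z.gcd_eq_0 in G; unfold n in G; lia).
  pose proof (Z.gcd_nonneg z (Z.of_nat n)) as G0; fold g in G0; lia. }
destruct (Z.gcd_divide_l z (Z.of_nat n)) as [p Hp].
destruct (Z.gcd_divide_r z (Z.of_nat n)) as [q Hq].
fold g in Hp, Hq.
assert (Hq0 : (0 < q)%Z) by (unfold n in Hq; nia).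
assert (Hqn : (q <= Z.of_nat n)%Z) by nia.
exists p, (Z.to_nat q); rewrite Z2Nat.id by lia.
assert (C : rel_prime p q).
{ apply Zgcd_1_rel_prime.
  apply (Z.mul_reg_l _ _ g); [lia|].
  rewrite Z.mul_1_r, Z.mul_comm, <- Z.gcd_mul_mono_r_nonneg by lia.
  now rewrite <- Hp, <- Hq. }
split; [unfold n in Hqn; lia|]; split; [exact C|].
rewrite INR_IZR_INZ, Z2Nat.id by lia.
rewrite Hp, (INR_IZR_INZ n), Hq, !mult_IZR in Hz.
apply IZR_lt in Hq0.
assert (G1 : 1 <= IZR g) by (apply IZR_le; lia).
set (qr := IZR q) in *; set (gr := IZR g) in *; set (pr := IZR p) in *.
apply Rmult_le_reg_l with qr; [lra|].
replace (qr * / (qr * INR Q)) with (/ INR Q) by (field; lra).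
rewrite <- (Rabs_pos_eq qr) at 1 by lra; rewrite <- Rabs_mult.
replace (qr * (x - pr / qr)) with (qr * x - pr) by (field; lra).
replace (qr * gr * x - pr * gr) with (gr * (qr * x - pr)) in Hz by ring.
rewrite Rabs_mult, (Rabs_pos_eq gr) in Hz by lra.
pose proof (Rabs_pos (qr * x - pr)); nra.
Qed.

(** * Weyl's inequality for quadratic exponential sums *)

(** Weyl differencing in real form: the squared modulus of [sum e^(i a n)] is a sum over pairs of
    indices, grouped by their difference [d], and the diagonal contributes [N]. *)
Lemma square_of_trig_sums (a : nat -> R) N :
  (lsum (fun n => cos (a n)) (seq 0 N))^2 + (lsum (fun n => sin (a n)) (seq 0 N))^2
  = INR N + 2 * lsum (fun d => lsum (fun n => cos (a (n + d)%nat - a n))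
                                    (seq 0 (N - d))) (seq 1 N).
Proof.
induction N as [|N IH]; [simpl; ring|].
rewrite !lsum_seq_S, S_INR.
(* The new difference [d = N + 1] has an empty inner sum, and every other [d] gains exactly one
   pair, [(N - d, N)]. *)
replace (S N - (1 + N))%nat with 0%nat by lia.
rewrite (lsum_ext _ (fun d => lsum (fun n => cos (a (n + d)%nat - a n)) (seq 0 (N - d))
           + cos (a N - a (N - d)%nat)) (seq 1 N)).
2: { intros d Hd; apply in_seq in Hd.
     replace (S N - d)%nat with (S (N - d)) by lia.
     rewrite lsum_seq_S; simpl; do 4 f_equal; lia. }
rewrite lsum_plus, (lsum_seq_rev (fun n => cos (a N - a n))).
rewrite (lsum_ext (fun n => cos (a N - a n))
          (fun n => cos (a N) * cos (a n) + sin (a N) * sin (a n)))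
  by (intros; apply cos_minus).
rewrite lsum_plus, !lsum_scal; simpl (0 + N)%nat; simpl (lsum _ (seq 0 0)).
pose proof (sin2_cos2 (a N)) as T; unfold Rsqr in T.
set (c := lsum (fun n => cos (a n)) _) in *; set (s := lsum (fun n => sin (a n)) _) in *.
set (L := lsum _ _) in *.
replace ((c + cos (a N))^2 + (s + sin (a N))^2) with
  ((c^2 + s^2) + (sin (a N) * sin (a N) + cos (a N) * cos (a N))
   + 2 * (cos (a N) * c + sin (a N) * s)) by ring.
rewrite IH, T; ring.
Qed.

(** Multiplication by [2 sin (b/2)] makes the sum telescope. The product form also covers the case
    where the sine vanishes. *)
Lemma cos_progression_bound (alpha b : R) M :
  Rabs (lsum (fun n => cos (alpha + INR n * b)) (seq 0 M)) * Rabs (sin (b / 2)) <= 1.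
Proof.
assert (E : 2 * (lsum (fun n => cos (alpha + INR n * b)) (seq 0 M) * sin (b / 2))
   = sin (alpha + INR M * b - b / 2) - sin (alpha - b / 2)).
{ induction M as [|M IH].
  { simpl; replace (alpha + 0 * b - b / 2) with (alpha - b / 2) by ring; ring. }
  rewrite lsum_seq_S, Rmult_plus_distr_r, Rmult_plus_distr_l, IH, S_INR; simpl.
  set (x := alpha + INR M * b).
  replace (alpha + (INR M + 1) * b - b / 2) with (x + b / 2) by (unfold x; field).
  rewrite (sin_plus x), (sin_minus x); ring. }
rewrite <- Rabs_mult.
pose proof (SIN_bound (alpha + INR M * b - b / 2)).
pose proof (SIN_bound (alpha - b / 2)).
apply Rabs_le; lra.
Qed.

Lemma Rabs_sin_plus_Zpi (x : R) (k : Z) : Rabs (sin (x + IZR k * PI)) = Rabs (sin x).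
Proof.
assert (S : sin (IZR k * PI) = 0) by (apply sin_eq_0_1; now exists k).
rewrite sin_plus, S, Rmult_0_r, Rplus_0_r, Rabs_mult.
pose proof (sin2_cos2 (IZR k * PI)) as T; rewrite S in T; unfold Rsqr in T.
assert (Rabs (cos (IZR k * PI)) = 1); [|nra].
pose proof (Rabs_pos (cos (IZR k * PI))).
pose proof (Rabs_mult (cos (IZR k * PI)) (cos (IZR k * PI))) as M.
rewrite Rabs_pos_eq in M by nra; nra.
Qed.

(** Half of Jordan's inequality is enough. With [x = PI v <= 2] the Taylor polynomial [sin_lb x] is
    at least [x (1 - x^2/6) >= x/3], and [PI > 3]. *)
Lemma sin_pi_ge v : 0 <= v <= / 2 -> v <= sin (PI * v).
Proof.
intros Hv.
pose proof PI_4 as P4; pose proof PI2_3_2 as P3.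
assert (0 <= PI * v) by nra; assert (PI * v <= PI / 2) by nra.
destruct (SIN (PI * v)) as [L _]; [lra|lra|].
apply Rle_trans with (2 := L).
set (x := PI * v) in *.
assert (x * x <= 4) by nra.
assert (v * 3 <= x) by (unfold x; nra).
replace (sin_lb x) with (x * (1 - x * x / 6 + (x * x)^2 * (42 - x * x) / 5040))
  by (unfold sin_lb, sin_approx, sin_term; simpl; field).
assert (0 <= (x * x)^2 * (42 - x * x)) by (apply Rmult_le_pos; nra).
nra.
Qed.

(** [|sin (PI u)|] dominates the distance from [u] to the nearest integer, which the bin index
    measures from the left end of the period or, reversed, from the right end. *)
Lemma Rabs_sin_ge_bin (u : R) m : (1 <= m)%nat ->
  INR (bin m u) / INR m <= Rabs (sin (PI * u)) \/
  INR (m - 1 - bin m u) / INR m <= Rabs (sin (PI * u)).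
Proof.
intros Hm.
destruct (bin_spec m u Hm) as [B [B1 B2]].
pose proof (base_fp u) as [F0 F1].
assert (M : 0 < INR m) by (apply lt_0_INR; lia).
set (v := frac_part u) in *.
replace (PI * u) with (PI * v + IZR (Int_part u) * PI)
  by (unfold v, frac_part; ring).
rewrite Rabs_sin_plus_Zpi.
destruct (Rle_dec v (/ 2)) as [Hv|Hv]; [left|right].
- apply Rle_trans with v.
  { apply Rmult_le_reg_l with (INR m); [lra|].
    replace (INR m * (INR (bin m u) / INR m)) with (INR (bin m u)) by (field; lra); lra. }
  apply Rle_trans with (2 := Rle_abs _), sin_pi_ge; lra.
- apply Rle_trans with (1 - v).
  { apply Rmult_le_reg_l with (INR m); [lra|].
    replace (INR m * (INR (m - 1 - bin m u) / INR m)) with (INR (m - 1 - bin m u))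
      by (field; lra).
    rewrite !minus_INR by lia; simpl; lra. }
  replace (PI * v) with (PI - PI * (1 - v)) by ring.
  rewrite <- sin_PI_x.
  replace (PI - (PI - PI * (1 - v))) with (PI * (1 - v)) by ring.
  apply Rle_trans with (2 := Rle_abs _), sin_pi_ge; lra.
Qed.

(* Since [2 |d - d'| <= q / 2 < q], the points [2 d y] are [1/(2q)]-separated
   modulo 1 and hence fall into distinct bins. *)
Lemma bin_double_injective (p : Z) (q : nat) (y : R) (d d' : nat) :
  (1 <= q)%nat -> rel_prime p (Z.of_nat q) ->
  Rabs (y - IZR p / INR q) <= / (INR q)^2 ->
  (d <= d')%nat -> (4 * (d' - d) <= q)%nat ->
  bin (2 * q) (2 * INR d' * y) = bin (2 * q) (2 * INR d * y) -> d = d'.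
Proof.
intros Hq C Hy Hd Hl E.
destruct (bin_eq (2 * q) _ _ ltac:(lia) E) as [z Hz].
assert (q0 : 1 <= INR q) by (change 1 with (INR 1); apply le_INR; lia).
set (l := (d' - d)%nat) in *.
replace (2 * INR d' * y - 2 * INR d * y) with (2 * INR l * y) in Hz
  by (unfold l; rewrite minus_INR by lia; ring).
set (beta := y - IZR p / INR q) in *.
assert (Hb : Rabs (2 * INR l * beta) <= / (2 * INR q)).
{ rewrite Rabs_mult, Rabs_pos_eq by (pose proof (pos_INR l); lra).
  apply le_INR in Hl; rewrite mult_INR in Hl; simpl (INR 4) in Hl.
  pose proof (pos_INR l).
  apply Rle_trans with (2 * INR l * / INR q ^ 2).
  { apply Rmult_le_compat_l; lra. }
  apply Rle_trans with (INR q / 2 * / INR q ^ 2).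
  { apply Rmult_le_compat_r; [|lra]. apply Rlt_le, Rinv_0_lt_compat; nra. }
  right; field; lra. }
rewrite mult_INR in Hz; change (INR 2) with 2 in Hz.
assert (T : Rabs (2 * INR l * (IZR p / INR q) - IZR z) < / INR q).
{ replace (2 * INR l * (IZR p / INR q) - IZR z) with
    ((2 * INR l * y - IZR z) - 2 * INR l * beta) by (unfold beta; ring).
  apply Rle_lt_trans with (1 := Rabs_triang _ _); rewrite Rabs_Ropp.
  replace (/ INR q) with (/ (2 * INR q) + / (2 * INR q)) by (field; lra).
  lra. }
(* An integer of absolute value below 1 vanishes, so [q] divides [2 l p], hence [2 l], which is
   impossible for [0 < 2 l <= q/2]. *)
assert (T2 : Rabs (IZR (2 * Z.of_nat l * p - z * Z.of_nat q)) < 1).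
{ rewrite minus_IZR, !mult_IZR, <- !INR_IZR_INZ.
  replace (2 * INR l * IZR p - IZR z * INR q) with
    (INR q * (2 * INR l * (IZR p / INR q) - IZR z)) by (field; lra).
  rewrite Rabs_mult, Rabs_pos_eq by lra.
  replace 1 with (INR q * / INR q) by (field; lra).
  apply Rmult_lt_compat_l; lra. }
rewrite <- abs_IZR in T2; apply lt_IZR in T2.
assert (D : (Z.of_nat q | p * (2 * Z.of_nat l))%Z) by (exists z; lia).
apply Gauss in D; [|now apply rel_prime_sym].
assert (l = 0)%nat; [|unfold l in *; lia].
destruct (Nat.eq_dec l 0) as [|L0]; [assumption|].
apply Z.divide_pos_le in D; lia.
Qed.

(** Within a block this short the points [2 d y] occupy distinct bins, so each term can be charged
    to its bin. Bin [i > 0] costs at most [2q/i]; bin 0 gives no lower bound on the sine and is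
    charged the trivial bound [X]. Counting bins from both ends of the period gives the factor 2. *)
Lemma weyl_block_bound (p : Z) (q : nat) (y X : R) (g : nat -> R) (D J : nat) :
  (1 <= q)%nat -> rel_prime p (Z.of_nat q) ->
  Rabs (y - IZR p / INR q) <= / (INR q)^2 -> (4 * (J - 1) <= q)%nat ->
  0 <= X -> (forall d, 0 <= g d <= X) ->
  (forall d, g d * Rabs (sin (2 * PI * INR d * y)) <= 1) ->
  lsum g (seq D J) <= 2 * (X + 2 * INR q * harmonic (2 * q)).
Proof.
intros Hq C Hy HJ HX Hg Hs.
set (m := (2 * q)%nat).
assert (Hm : (1 <= m)%nat) by (unfold m; lia).
assert (M : INR m = 2 * INR q) by (unfold m; rewrite mult_INR; simpl; ring).
assert (q0 : 1 <= INR q) by (change 1 with (INR 1); apply le_INR; lia).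
set (w := fun i => match i with O => X | S _ => INR m / INR i end).
assert (w0 : forall i, 0 <= w i).
{ intros [|i]; unfold w; [assumption|].
  apply Rlt_le, Rdiv_lt_0_compat; [lra|apply lt_0_INR; lia]. }
assert (Hw : forall d i, INR i / INR m <= Rabs (sin (PI * (2 * INR d * y))) -> g d <= w i).
{ intros d [|i] Hi; unfold w; [apply Hg|].
  assert (0 < INR (S i)) by (apply lt_0_INR; lia).
  specialize (Hs d).
  replace (2 * PI * INR d * y) with (PI * (2 * INR d * y)) in Hs by ring.
  apply Rmult_le_reg_r with (INR (S i) / INR m); [apply Rdiv_lt_0_compat; lra|].
  replace (INR m / INR (S i) * (INR (S i) / INR m)) with 1 by (field; lra).
  apply Rle_trans with (2 := Hs), Rmult_le_compat_l; [apply Hg|assumption]. }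
set (b := fun d => bin m (2 * INR d * y)).
apply Rle_trans with (lsum (fun d => w (b d) + w (m - 1 - b d)%nat) (seq D J)).
{ apply lsum_le; intros d _.
  pose proof (w0 (b d)); pose proof (w0 (m - 1 - b d)%nat).
  destruct (Rabs_sin_ge_bin (2 * INR d * y) m Hm) as [H1|H1];
    apply Hw in H1; unfold b; fold (b d); fold (b d) in H1; lra. }
rewrite <- (lsum_map b (fun i => w i + w (m - 1 - i)%nat)).
apply Rle_trans with (lsum (fun i => w i + w (m - 1 - i)%nat) (seq 0 m)).
{ apply lsum_incl.
  - apply NoDup_map_inj_on; [apply seq_NoDup|].
    intros d d' Hd Hd' E; apply in_seq in Hd; apply in_seq in Hd'.
    destruct (Nat.le_ge_cases d d') as [L|L].
    + apply (bin_double_injective p q y); auto; lia.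
    + symmetry; apply (bin_double_injective p q y); auto; lia.
  - intros i Hi; apply in_map_iff in Hi as [d [<- _]].
    apply in_seq; destruct (bin_spec m (2 * INR d * y) Hm); unfold b; lia.
  - intros i _; pose proof (w0 i); pose proof (w0 (m - 1 - i)%nat); lra. }
rewrite lsum_plus, lsum_seq_rev0.
assert (W : lsum w (seq 0 m) <= X + INR m * harmonic m); [|rewrite M in W; lra].
replace (seq 0 m) with (0%nat :: seq 1 (m - 1))
  by (replace m with (S (m - 1)) at 2 by lia; reflexivity).
simpl; apply Rplus_le_compat_l.
apply Rle_trans with (INR m * harmonic (m - 1)).
- unfold harmonic; rewrite <- lsum_scal; apply lsum_le.
  intros i Hi; apply in_seq in Hi; destruct i as [|i]; [lia|]; unfold w; lra.
- apply Rmult_le_compat_l; [lra|apply harmonic_incr; lia].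
Qed.

Lemma lsum_blocks (g : nat -> R) J X : (forall D, lsum g (seq D J) <= X) ->
  forall b D, lsum g (seq D (b * J)) <= INR b * X.
Proof.
intros H; induction b as [|b IH]; intros D; [simpl; lra|].
simpl Nat.mul; rewrite seq_app, lsum_app, S_INR.
specialize (H D); specialize (IH (D + J)%nat); lra.
Qed.

Definition cos_sum (y : R) (N : nat) : R :=
  lsum (fun n => cos (2 * PI * (INR n)^2 * y)) (seq 0 N).
Definition sin_sum (y : R) (N : nat) : R :=
  lsum (fun n => sin (2 * PI * (INR n)^2 * y)) (seq 0 N).

(** Since [(n + d)^2 - n^2] is linear in [n], differencing leaves cosines of progressions, bounded
    by [1 / |sin (2 PI d y)|] as well as by [N]. The range of [d] is then cut into blocks of about
    [q/4] terms. *)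
Theorem weyl_inequality (p : Z) (q N : nat) (y : R) :
  (1 <= q <= N)%nat -> rel_prime p (Z.of_nat q) ->
  Rabs (y - IZR p / INR q) <= / (INR q)^2 ->
  (cos_sum y N)^2 + (sin_sum y N)^2 <= 61 * harmonic (2 * q) * (INR N)^2 / INR q.
Proof.
intros [Hq HN] C Hy.
unfold cos_sum, sin_sum.
rewrite (square_of_trig_sums (fun n => 2 * PI * (INR n)^2 * y)).
set (g := fun d => Rabs (lsum (fun n => cos (2 * PI * INR (n + d) ^ 2 * y
                     - 2 * PI * INR n ^ 2 * y)) (seq 0 (N - d)))).
assert (q0 : 1 <= INR q) by (change 1 with (INR 1); apply le_INR; lia).
assert (N0 : INR q <= INR N) by (apply le_INR; lia).
assert (Hg : forall d, 0 <= g d <= INR N).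
{ intros d; split; [apply Rabs_pos|].
  eapply Rle_trans; [apply lsum_Rabs|].
  apply Rle_trans with (lsum (fun _ => 1) (seq 0 (N - d))).
  - apply lsum_le; intros n _; apply Rabs_le, COS_bound.
  - rewrite lsum_const, length_seq, Rmult_1_r; apply le_INR; lia. }
assert (Hs : forall d, g d * Rabs (sin (2 * PI * INR d * y)) <= 1).
{ intros d; unfold g.
  rewrite (lsum_ext _ (fun n => cos (2 * PI * INR d ^ 2 * y + INR n * (4 * PI * INR d * y)))).
  - replace (2 * PI * INR d * y) with (4 * PI * INR d * y / 2) by field.
    apply cos_progression_bound.
  - intros n _; rewrite plus_INR; f_equal; ring. }
(* [J] is the largest block length with [4 (J - 1) <= q]. As [q <= 4 J], the [b] blocks needed
   satisfy [b q <= 4 N + q <= 5 N]. *)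
set (J := (q / 4 + 1)%nat).
set (b := (N / J + 1)%nat).
pose proof (Nat.div_mod_eq q 4) as D1; pose proof (Nat.mod_upper_bound q 4 ltac:(lia)) as D2.
assert (HJ : (J <> 0)%nat) by (unfold J; lia).
pose proof (Nat.div_mod_eq N J) as D3; pose proof (Nat.mod_upper_bound N J HJ) as D4.
set (H := harmonic (2 * q)).
assert (H1 : 1 <= H) by (apply harmonic_ge1; lia).
set (X := 2 * (INR N + 2 * INR q * H)).
assert (S : lsum g (seq 1 N) <= INR b * X).
{ apply Rle_trans with (lsum g (seq 1 (b * J))).
  - apply lsum_incl; [apply seq_NoDup| |intros; apply Hg].
    intros i Hi; apply in_seq in Hi; apply in_seq; unfold b; nia.
  - apply lsum_blocks; intros D.
    apply (weyl_block_bound p q y); auto; [unfold J; lia|lra]. }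
assert (B : INR b * INR q <= 5 * INR N).
{ rewrite <- mult_INR; apply Rle_trans with (INR (5 * N)).
  - apply le_INR; unfold b.
    assert (N / J * J <= N)%nat by lia.
    assert (q <= 4 * J)%nat by (unfold J; lia).
    nia.
  - rewrite mult_INR; simpl; lra. }
apply Rle_trans with (INR N + 2 * (INR b * X)).
{ apply Rplus_le_compat_l, Rmult_le_compat_l; [lra|].
  apply Rle_trans with (2 := S), lsum_le; intros d _; apply Rle_abs. }
(* After multiplication by [q] the bound is [N q + 4 b q (N + 2 q H)], at most
   [N^2 + 20 N^2 + 40 N^2 H]. With [H >= 1] this gives the constant [61 = 1 + 20 + 40]. *)
apply Rmult_le_reg_r with (INR q); [lra|].
replace (61 * H * INR N ^ 2 / INR q * INR q) with (61 * H * INR N ^ 2) by (field; lra).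
set (n := INR N) in *; set (r := INR q) in *; set (c := INR b) in *.
unfold X.
replace ((n + 2 * (c * (2 * (n + 2 * r * H)))) * r)
  with (n * r + 4 * (c * r) * (n + 2 * r * H)) by ring.
assert (4 * (c * r) * (n + 2 * r * H) <= 4 * (5 * n) * (n + 2 * n * H)).
{ apply Rmult_le_compat; try nra.
  unfold c; pose proof (pos_INR b); nra. }
assert (n * r <= n * n) by nra.
assert (n * n * 1 <= n * n * H) by (apply Rmult_le_compat_l; nra).
nra.
Qed.

(** * Partial sums of Riemann's function *)

(* The variable is rescaled to [x = 2 PI t], so that the frequencies become
   [2 PI k^2] and the special points are the rationals. *)
Definition re_part (x : R) (N : nat) : R :=
  lsum (fun k => (1 - cos (2 * PI * (INR k)^2 * x)) / (2 * PI^2 * (INR k)^2)) (seq 1 N).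
Definition im_part (x : R) (N : nat) : R :=
  x / (2 * PI) +
  lsum (fun k => sin (2 * PI * (INR k)^2 * x) / (2 * PI^2 * (INR k)^2)) (seq 1 N).

Lemma psum_even (f : Z -> R -> R) t N : (forall k, f (- k)%Z t = f k t) ->
  psum f t N = f 0%Z t + lsum (fun k => 2 * f (Z.of_nat k) t) (seq 1 N).
Proof.
intros Hf; induction N as [|N IH]; [unfold psum; simpl; ring|].
rewrite lsum_seq_S, <- Rplus_assoc, <- IH; unfold psum.
replace (2 * S N)%nat with (S (S (2 * N))) by lia.
(* Removing both the last and the first index of the window from [- S N] to [S N] leaves the window
   from [- N] to [N]. *)
rewrite tech5, decomp_sum by lia.
change (Init.Nat.pred (S (2 * N))) with (2 * N)%nat.
rewrite (sum_eq _ (fun n => f (Z.of_nat n - Z.of_nat N)%Z t))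
  by (intros i _; f_equal; lia).
replace (Z.of_nat 0 - Z.of_nat (S N))%Z with (- Z.of_nat (S N))%Z by lia.
replace (Z.of_nat (S (S (2 * N))) - Z.of_nat (S N))%Z with (Z.of_nat (S N)) by lia.
replace (1 + N)%nat with (S N) by lia.
rewrite Hf; ring.
Qed.

Lemma psum_rterm_re t N : psum rterm_re t N = re_part (2 * PI * t) N.
Proof.
pose proof PI_RGT_0.
rewrite psum_even.
- unfold rterm_re at 1; simpl; rewrite Rplus_0_l.
  apply lsum_ext; intros k Hk; apply in_seq in Hk.
  assert (INR k <> 0) by (apply not_0_INR; lia).
  unfold rterm_re; destruct (Z.eq_dec _ _) as [E|_]; [lia|].
  rewrite <- INR_IZR_INZ.
  replace (4 * PI ^ 2 * INR k ^ 2 * t) with (2 * PI * INR k ^ 2 * (2 * PI * t)) by ring.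
  field; split; [assumption|lra].
- intros k; unfold rterm_re.
  destruct (Z.eq_dec k 0), (Z.eq_dec (- k) 0); try lia; [reflexivity|].
  rewrite opp_IZR; replace ((- IZR k)^2) with (IZR k ^ 2) by ring; reflexivity.
Qed.

Lemma psum_rterm_im t N : psum rterm_im t N = im_part (2 * PI * t) N.
Proof.
pose proof PI_RGT_0.
rewrite psum_even.
- unfold rterm_im at 1, im_part; simpl (Z.eq_dec 0 0).
  f_equal; [simpl; field; lra|].
  apply lsum_ext; intros k Hk; apply in_seq in Hk.
  assert (INR k <> 0) by (apply not_0_INR; lia).
  unfold rterm_im; destruct (Z.eq_dec _ _) as [E|_]; [lia|].
  rewrite <- INR_IZR_INZ.
  replace (4 * PI ^ 2 * INR k ^ 2 * t) with (2 * PI * INR k ^ 2 * (2 * PI * t)) by ring.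
  field; split; [assumption|lra].
- intros k; unfold rterm_im.
  destruct (Z.eq_dec k 0), (Z.eq_dec (- k) 0); try lia; [reflexivity|].
  rewrite opp_IZR; replace ((- IZR k)^2) with (IZR k ^ 2) by ring; reflexivity.
Qed.

Lemma derivable_pt_lim_cos_scal c x :
  derivable_pt_lim (fun y => cos (c * y)) x (- c * sin (c * x)).
Proof.
replace (- c * sin (c * x)) with (- sin (c * x) * (c * 1)) by ring.
apply (derivable_pt_lim_comp (mult_real_fct c id) cos).
- apply derivable_pt_lim_scal, derivable_pt_lim_id.
- apply derivable_pt_lim_cos.
Qed.

Lemma derivable_pt_lim_sin_scal c x :
  derivable_pt_lim (fun y => sin (c * y)) x (c * cos (c * x)).
Proof.
replace (c * cos (c * x)) with (cos (c * x) * (c * 1)) by ring.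
apply (derivable_pt_lim_comp (mult_real_fct c id) sin).
- apply derivable_pt_lim_scal, derivable_pt_lim_id.
- apply derivable_pt_lim_sin.
Qed.

Lemma derivable_pt_lim_lsum {A : Type} (f f' : A -> R -> R) l x :
  (forall a, In a l -> derivable_pt_lim (f a) x (f' a x)) ->
  derivable_pt_lim (fun y => lsum (fun a => f a y) l) x (lsum (fun a => f' a x) l).
Proof.
induction l as [|a l IH]; intros H; simpl.
- apply derivable_pt_lim_const.
- apply (derivable_pt_lim_plus (f a)); [apply H; now left|].
  apply IH; intros b Hb; apply H; now right.
Qed.

(* The denominators [k^2] are exactly what differentiation in [x] produces, so
   the derivative of a partial sum is a quadratic exponential sum. *)
Lemma re_part_derive x K : derivable_pt_lim (fun y => re_part y K) x (sin_sum x (S K) / PI).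
Proof.
pose proof PI_RGT_0.
replace (sin_sum x (S K) / PI) with
  (lsum (fun k => / PI * sin (2 * PI * (INR k)^2 * x)) (seq 1 K)).
2: { rewrite lsum_scal; unfold sin_sum; simpl.
     replace (2 * PI * (0 * (0 * 1)) * x) with 0 by ring.
     rewrite sin_0; unfold Rdiv; ring. }
apply (derivable_pt_lim_lsum
  (fun k y => (1 - cos (2 * PI * (INR k)^2 * y)) / (2 * PI^2 * (INR k)^2))
  (fun k y => / PI * sin (2 * PI * (INR k)^2 * y))).
intros k Hk; apply in_seq in Hk.
assert (INR k <> 0) by (apply not_0_INR; lia).
set (c := 2 * PI * (INR k)^2).
replace (/ PI * sin (c * x)) with
  ((0 - - c * sin (c * x)) * / (2 * PI^2 * (INR k)^2)
   + (1 - cos (c * x)) * 0)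
  by (unfold c; field; split; [lra|assumption]).
apply (derivable_pt_lim_mult (fun y => 1 - cos (c * y)) (fun _ => / (2 * PI^2 * (INR k)^2)));
  [|apply derivable_pt_lim_const].
apply (derivable_pt_lim_minus (fun _ => 1)); [apply derivable_pt_lim_const|].
apply derivable_pt_lim_cos_scal.
Qed.

(** The derivative is [1 / (2 PI)] times the sum of the cosines over [|k| <= K]. That sum is
    [2 * cos_sum x (S K) - 1], because the index 0, coming from the linear term, must not be
    doubled. *)
Lemma im_part_derive x K :
  derivable_pt_lim (fun y => im_part y K) x ((cos_sum x (S K) - / 2) / PI).
Proof.
pose proof PI_RGT_0.
replace ((cos_sum x (S K) - / 2) / PI) with
  (/ (2 * PI) * 1 + lsum (fun k => / PI * cos (2 * PI * (INR k)^2 * x)) (seq 1 K)).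
2: { rewrite lsum_scal; unfold cos_sum; simpl.
     replace (2 * PI * (0 * (0 * 1)) * x) with 0 by ring.
     rewrite cos_0; field; lra. }
apply (derivable_pt_lim_plus (fun y => y / (2 * PI))).
{ apply (derivable_pt_lim_ext (mult_real_fct (/ (2 * PI)) id)).
  - intros z; unfold mult_real_fct, id, Rdiv; ring.
  - apply derivable_pt_lim_scal, derivable_pt_lim_id. }
apply (derivable_pt_lim_lsum
  (fun k y => sin (2 * PI * (INR k)^2 * y) / (2 * PI^2 * (INR k)^2))
  (fun k y => / PI * cos (2 * PI * (INR k)^2 * y))).
intros k Hk; apply in_seq in Hk.
assert (INR k <> 0) by (apply not_0_INR; lia).
set (c := 2 * PI * (INR k)^2).
replace (/ PI * cos (c * x)) with
  (c * cos (c * x) * / (2 * PI^2 * (INR k)^2) + sin (c * x) * 0)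
  by (unfold c; field; split; [lra|assumption]).
apply (derivable_pt_lim_mult (fun y => sin (c * y)) (fun _ => / (2 * PI^2 * (INR k)^2)));
  [|apply derivable_pt_lim_const].
apply derivable_pt_lim_sin_scal.
Qed.

(** * Oscillation of partial sums on an interval *)

Lemma lipschitz_of_derivative_bound (f f' : R -> R) a b L :
  (forall y, derivable_pt_lim f y (f' y)) ->
  (forall y, a <= y <= b -> Rabs (f' y) <= L) ->
  forall x x', a <= x <= b -> a <= x' <= b -> Rabs (f x - f x') <= L * Rabs (x - x').
Proof.
intros Df Hf x x' Hx Hx'.
destruct (MVT_abs f f' x' x) as [c [E Hc]]; [auto|].
rewrite E; apply Rmult_le_compat_r; [apply Rabs_pos|apply Hf].
destruct Hc as [H1 H2].
assert (a <= Rmin x' x) by (apply Rmin_glb; lra).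
assert (Rmax x' x <= b) by (apply Rmax_lub; lra).
lra.
Qed.

(** Summation by parts: the interior terms [S (m+1) (1/m^2 - 1/(m+1)^2)] are at most
    [3 B (1/m - 1/(m+1))] and telescope to at most [3 B / K]; the two boundary terms add at most
    [B / K] each. *)
Lemma abel_tail_bound (a : nat -> R) (B : R) (K n : nat) : (1 <= K)%nat ->
  (forall m, (K <= m)%nat -> Rabs (lsum a (seq 0 m)) <= B * INR m) ->
  Rabs (lsum (fun k => a k / (INR k)^2) (seq K n)) <= 5 * B / INR K.
Proof.
intros HK Ha.
assert (K0 : 1 <= INR K) by (change 1 with (INR 1); now apply le_INR).
assert (B0 : 0 <= B).
{ specialize (Ha K (le_n K)); pose proof (Rabs_pos (lsum a (seq 0 K))); nra. }
set (S := fun m => lsum a (seq 0 m)) in *.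
assert (E : Rabs (lsum (fun k => a k / (INR k)^2) (seq K n)
   - S (K + n)%nat / (INR (K + n))^2 + S K / (INR K)^2)
   <= 3 * B * (/ INR K - / INR (K + n))).
{ induction n as [|n IH].
  - rewrite Nat.add_0_r; simpl lsum.
    replace (0 - S K / INR K ^ 2 + S K / INR K ^ 2) with 0 by ring.
    rewrite Rabs_R0; lra.
  - rewrite lsum_seq_S.
    replace (K + Datatypes.S n)%nat with (Datatypes.S (K + n)) by lia.
    assert (Hm := Ha (Datatypes.S (K + n)) ltac:(lia)).
    assert (Sm : S (Datatypes.S (K + n)) = S (K + n)%nat + a (K + n)%nat)
      by (unfold S; now rewrite lsum_seq_S).
    set (m := (K + n)%nat) in *.
    assert (m0 : 1 <= INR m)
      by (change 1 with (INR 1); apply le_INR; unfold m; lia).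
    change (lsum a (seq 0 (Datatypes.S m))) with (S (Datatypes.S m)) in Hm.
    set (T := lsum _ (seq K n)) in *.
    rewrite S_INR in *; set (u := INR m) in *.
    replace (T + a m / u ^ 2 - S (Datatypes.S m) / (u + 1) ^ 2 + S K / INR K ^ 2)
      with ((T - S m / u ^ 2 + S K / INR K ^ 2)
            + S (Datatypes.S m) * ((2 * u + 1) / (u ^ 2 * (u + 1) ^ 2)))
      by (rewrite Sm; field; lra).
    eapply Rle_trans; [apply Rabs_triang|].
    replace (3 * B * (/ INR K - / (u + 1))) with
      (3 * B * (/ INR K - / u) + 3 * B * (/ u - / (u + 1))) by ring.
    apply Rplus_le_compat; [exact IH|].
    assert (P : 0 < (2 * u + 1) / (u ^ 2 * (u + 1) ^ 2)).
    { apply Rdiv_lt_0_compat; [lra|].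
      apply Rmult_lt_0_compat; apply pow_lt; lra. }
    rewrite Rabs_mult, (Rabs_pos_eq ((2 * u + 1) / _)) by lra.
    apply Rle_trans with (B * (u + 1) * ((2 * u + 1) / (u ^ 2 * (u + 1) ^ 2))).
    { apply Rmult_le_compat_r; [lra|exact Hm]. }
    replace (B * (u + 1) * ((2 * u + 1) / (u ^ 2 * (u + 1) ^ 2))) with
      (B * (2 * u + 1) * / (u ^ 2 * (u + 1))) by (field; lra).
    replace (3 * B * (/ u - / (u + 1))) with (B * (3 * u) * / (u ^ 2 * (u + 1)))
      by (field; lra).
    apply Rmult_le_compat_r.
    + apply Rlt_le, Rinv_0_lt_compat, Rmult_lt_0_compat; [apply pow_lt|]; lra.
    + nra. }
assert (Q : forall m, (K <= m)%nat -> Rabs (S m / (INR m)^2) <= B / INR m).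
{ intros m Hm.
  assert (m0 : 1 <= INR m)
    by (change 1 with (INR 1); apply le_INR; lia).
  unfold Rdiv; rewrite Rabs_mult, (Rabs_pos_eq (/ _))
    by (apply Rlt_le, Rinv_0_lt_compat, pow_lt; lra).
  replace (B * / INR m) with (B * INR m * / INR m ^ 2) by (field; lra).
  apply Rmult_le_compat_r; [apply Rlt_le, Rinv_0_lt_compat, pow_lt; lra|].
  now apply Ha. }
pose proof (Q K (le_n K)) as Q1; pose proof (Q (K + n)%nat ltac:(lia)) as Q2.
assert (I : 0 < / INR (K + n) <= / INR K).
{ split; [apply Rinv_0_lt_compat, lt_0_INR; lia|].
  apply Rinv_le_contravar; [lra|apply le_INR; lia]. }
unfold Rdiv in *.
set (T := lsum _ _) in *; set (x1 := S K * _) in *; set (x2 := S (K + n)%nat * _) in *.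
replace T with ((T - x2 + x1) + (x2 - x1)) by ring.
eapply Rle_trans; [apply Rabs_triang|].
assert (Rabs (x2 - x1) <= Rabs x2 + Rabs x1)
  by (eapply Rle_trans; [apply Rabs_triang|rewrite Rabs_Ropp; lra]).
assert (B * / INR (K + n) <= B * / INR K) by (apply Rmult_le_compat_l; lra).
assert (0 <= B * / INR (K + n)) by (apply Rmult_le_pos; lra).
lra.
Qed.

Section Variation.

Variables (a b B : R) (K : nat).
Hypothesis K_ge1 : (1 <= K)%nat.
Hypothesis BK_ge1 : 1 <= B * INR K.
Hypothesis cos_sum_le : forall y n, a <= y <= b -> (K <= n)%nat ->
  Rabs (cos_sum y n) <= B * INR n.
Hypothesis sin_sum_le : forall y n, a <= y <= b -> (K <= n)%nat ->
  Rabs (sin_sum y n) <= B * INR n.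

(** Here [c] is the cosine or the sine. As [5 / (2 PI^2) <= 5/18 < 1/2], the tails at two points
    cost at most [B / K] together. *)
Let tail_le (c : R -> R) y n : a <= y <= b ->
  (forall m, (K <= m)%nat ->
    Rabs (lsum (fun k => c (2 * PI * (INR k)^2 * y)) (seq 0 m)) <= B * INR m) ->
  Rabs (lsum (fun k => c (2 * PI * (INR k)^2 * y) / (2 * PI^2 * (INR k)^2)) (seq K n))
  <= B / INR K / 2.
Proof.
intros Hy Hc.
pose proof PI2_3_2 as P.
assert (K0 : 1 <= INR K) by (change 1 with (INR 1); now apply le_INR).
assert (B0 : 0 < B) by nra.
rewrite (lsum_ext _ (fun k => / (2 * PI^2) * (c (2 * PI * (INR k)^2 * y) / (INR k)^2))).
2: { intros k Hk; apply in_seq in Hk.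
     assert (INR k <> 0) by (apply not_0_INR; lia).
     field; split; [assumption|lra]. }
assert (P2 : 18 < 2 * PI ^ 2) by nra.
rewrite lsum_scal, Rabs_mult, Rabs_pos_eq
  by (apply Rlt_le, Rinv_0_lt_compat; lra).
apply Rle_trans with (/ 18 * (5 * B / INR K)).
- apply Rmult_le_compat; try apply Rabs_pos.
  + apply Rlt_le, Rinv_0_lt_compat; lra.
  + apply Rinv_le_contravar; lra.
  + now apply abel_tail_bound.
- assert (0 < B / INR K) by (apply Rdiv_lt_0_compat; lra).
  replace (/ 18 * (5 * B / INR K)) with (5 / 18 * (B / INR K)) by (field; lra); lra.
Qed.

Lemma re_part_variation x x' N : a <= x <= b -> a <= x' <= b -> (K <= N)%nat ->
  Rabs (re_part x N - re_part x' N) <= B * (INR K * Rabs (x - x') + / INR K).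
Proof.
intros Hx Hx' HN.
pose proof PI2_3_2 as P.
assert (K0 : 1 <= INR K) by (change 1 with (INR 1); now apply le_INR).
pose proof (tail_le cos x (N - (K - 1)) Hx (fun m Hm => cos_sum_le x m Hx Hm)) as T.
pose proof (tail_le cos x' (N - (K - 1)) Hx' (fun m Hm => cos_sum_le x' m Hx' Hm)) as T'.
(* The tail of [1 / (2 PI^2 k^2)] does not depend on [y] and cancels in the difference, so only the
   cosine tail matters. Cutting after [K - 1] makes the derivative of the head an exponential sum of
   length exactly [K]. *)
assert (E : forall y, re_part y N = re_part y (K - 1)
  + (lsum (fun k => / (2 * PI^2 * (INR k)^2)) (seq K (N - (K - 1)))
     - lsum (fun k => cos (2 * PI * (INR k)^2 * y) / (2 * PI^2 * (INR k)^2))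
         (seq K (N - (K - 1))))).
{ intros y; unfold re_part.
  replace N with ((K - 1) + (N - (K - 1)))%nat at 1 by lia.
  rewrite seq_app, lsum_app; f_equal.
  replace (1 + (K - 1))%nat with K by lia.
  apply Rplus_eq_reg_r with
    (lsum (fun k => cos (2 * PI * (INR k)^2 * y) / (2 * PI^2 * (INR k)^2))
         (seq K (N - (K - 1)))).
  rewrite <- lsum_plus.
  match goal with |- _ = ?u - ?v + ?v => replace (u - v + v) with u by ring end.
  apply lsum_ext; intros k _; unfold Rdiv; ring. }
assert (L : Rabs (re_part x (K - 1) - re_part x' (K - 1)) <= B * INR K * Rabs (x - x')).
{ apply (lipschitz_of_derivative_bound (fun y => re_part y (K - 1))
    (fun y => sin_sum y (S (K - 1)) / PI) a b); auto.
  - intros y; apply re_part_derive.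
  - intros y Hy; replace (S (K - 1)) with K by lia.
    pose proof (sin_sum_le y K Hy (le_n K)).
    unfold Rdiv; rewrite Rabs_mult, (Rabs_pos_eq (/ PI))
      by (apply Rlt_le, Rinv_0_lt_compat; lra).
    apply Rmult_le_reg_r with PI; [lra|].
    rewrite Rmult_assoc, Rinv_l, Rmult_1_r by lra; nra. }
rewrite !E.
apply Rabs_le_inv in T, T', L.
unfold Rdiv in *; apply Rabs_le; lra.
Qed.

Lemma im_part_variation x x' N : a <= x <= b -> a <= x' <= b -> (K <= N)%nat ->
  Rabs (im_part x N - im_part x' N) <= B * (INR K * Rabs (x - x') + / INR K).
Proof.
intros Hx Hx' HN.
pose proof PI2_3_2 as P.
assert (K0 : 1 <= INR K) by (change 1 with (INR 1); now apply le_INR).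
pose proof (tail_le sin x (N - (K - 1)) Hx (fun m Hm => sin_sum_le x m Hx Hm)) as T.
pose proof (tail_le sin x' (N - (K - 1)) Hx' (fun m Hm => sin_sum_le x' m Hx' Hm)) as T'.
assert (E : forall y, im_part y N = im_part y (K - 1)
  + lsum (fun k => sin (2 * PI * (INR k)^2 * y) / (2 * PI^2 * (INR k)^2))
         (seq K (N - (K - 1)))).
{ intros y; unfold im_part.
  replace N with ((K - 1) + (N - (K - 1)))%nat at 1 by lia.
  rewrite seq_app, lsum_app.
  replace (1 + (K - 1))%nat with K by lia; ring. }
assert (L : Rabs (im_part x (K - 1) - im_part x' (K - 1)) <= B * INR K * Rabs (x - x')).
{ apply (lipschitz_of_derivative_bound (fun y => im_part y (K - 1))
    (fun y => (cos_sum y (S (K - 1)) - / 2) / PI) a b); auto.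
  - intros y; apply im_part_derive.
  - intros y Hy; replace (S (K - 1)) with K by lia.
    pose proof (cos_sum_le y K Hy (le_n K)) as C; apply Rabs_le_inv in C.
    unfold Rdiv; rewrite Rabs_mult, (Rabs_pos_eq (/ PI))
      by (apply Rlt_le, Rinv_0_lt_compat; lra).
    (* [BK_ge1] absorbs the [1/2], and the division by [PI > 3] compensates the factor 2. *)
    assert (Rabs (cos_sum y K - / 2) <= 2 * (B * INR K)) by (apply Rabs_le; lra).
    apply Rmult_le_reg_r with PI; [lra|].
    rewrite Rmult_assoc, Rinv_l, Rmult_1_r by lra; nra. }
rewrite !E.
apply Rabs_le_inv in T, T', L.
unfold Rdiv in *; apply Rabs_le; lra.
Qed.

End Variation.

(** * Oscillation of the limit near a rational *)

Lemma Un_cv_dist_le (u v : nat -> R) l l' c K : Un_cv u l -> Un_cv v l' ->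
  (forall n, (K <= n)%nat -> Rabs (u n - v n) <= c) -> Rabs (l - l') <= c.
Proof.
intros Hu Hv H.
apply le_epsilon; intros e He.
destruct (Hu (e / 2) ltac:(lra)) as [N1 H1].
destruct (Hv (e / 2) ltac:(lra)) as [N2 H2].
set (n := (N1 + N2 + K)%nat).
specialize (H1 n ltac:(unfold n; lia)); specialize (H2 n ltac:(unfold n; lia)).
specialize (H n ltac:(unfold n; lia)); unfold Rdist in *.
apply Rabs_def2 in H1, H2; apply Rabs_le_inv in H; apply Rabs_le; lra.
Qed.

Lemma dist2_le (P P' : pt) c c' : Rabs (fst P - fst P') <= c ->
  Rabs (snd P - snd P') <= c' -> dist2 P P' <= c + c'.
Proof.
unfold dist2; set (x := fst P - fst P'); set (y := snd P - snd P'); intros Hx Hy.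
pose proof (Rabs_pos x); pose proof (Rabs_pos y).
rewrite <- (sqrt_Rsqr (c + c')) by lra.
apply sqrt_le_1_alt; unfold Rsqr.
rewrite <- (pow2_abs x), <- (pow2_abs y); nra.
Qed.

(** Taking the harmonic number at [2 Q] instead of [2 q] leaves [1/q] as the only dependence on [q].
    The constant is [80 = 2 * 5 * 8]: two coordinates, a bound [5 B / w] for each with
    [w = sqrt (q Q)], and the 8 in [B]. *)
Definition radius (Q q : nat) : R :=
  80 * sqrt (harmonic (2 * Q) / INR Q) / INR q.

Lemma radius_pos Q q : (1 <= Q)%nat -> (1 <= q)%nat -> 0 < radius Q q.
Proof.
intros HQ Hq; unfold radius.
pose proof (harmonic_ge1 (2 * Q) ltac:(lia)).
apply Rdiv_lt_0_compat; [|apply lt_0_INR; lia].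
apply Rmult_lt_0_compat; [lra|].
apply sqrt_lt_R0, Rdiv_lt_0_compat; [lra|apply lt_0_INR; lia].
Qed.

(* Splitting the series at [K ~ sqrt (q Q)] balances the two error terms. *)
Theorem phi_oscillation_near_rational (p : Z) (q Q : nat) t t' P P' :
  (1 <= q <= Q)%nat -> rel_prime p (Z.of_nat q) ->
  Rabs (2 * PI * t - IZR p / INR q) <= / (INR q * INR Q) ->
  Rabs (2 * PI * t' - IZR p / INR q) <= / (INR q * INR Q) ->
  phi_val t P -> phi_val t' P' -> dist2 P P' <= radius Q q.
Proof.
intros Hq C Ht Ht' [P1 P2] [P1' P2'].
assert (q0 : 1 <= INR q) by (change 1 with (INR 1); apply le_INR; lia).
assert (qQ : INR q <= INR Q) by (apply le_INR; lia).
set (x := 2 * PI * t) in *; set (x' := 2 * PI * t') in *.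
set (w := sqrt (INR q * INR Q)).
assert (ww : w * w = INR q * INR Q) by (apply sqrt_sqrt; nra).
assert (w0 : 0 <= w) by apply sqrt_pos.
assert (wq : INR q <= w) by nra.
set (H := harmonic (2 * Q)).
assert (H1 : 1 <= H) by (apply harmonic_ge1; lia).
(* [64] is the first perfect square above the constant [61] of Weyl's inequality. *)
set (B := 8 * sqrt (H / INR q)).
assert (BB : B * B = 64 * H / INR q).
{ unfold B; replace (8 * sqrt (H / INR q) * (8 * sqrt (H / INR q)))
    with (64 * (sqrt (H / INR q) * sqrt (H / INR q))) by ring.
  rewrite sqrt_sqrt; [field; lra|].
  apply Rlt_le, Rdiv_lt_0_compat; lra. }
assert (B0 : 0 <= B) by (pose proof (sqrt_pos (H / INR q)); unfold B; lra).
destruct (base_Int_part w) as [K1 K2].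
set (k := Int_part w) in *.
assert (k0 : (0 <= k)%Z) by (apply Z.lt_succ_r, lt_IZR; rewrite succ_IZR; lra).
(* [K] is the integer part of [w] plus one: [K > w >= q] makes Weyl's inequality available for every
   length from [K] on, while [K <= 2 w]. *)
set (K := Z.to_nat (k + 1)).
assert (EK : INR K = IZR k + 1).
{ unfold K; rewrite INR_IZR_INZ, Z2Nat.id by lia; now rewrite plus_IZR. }
assert (HKq : (q <= K)%nat) by (apply INR_le; lra).
set (e := / (INR q * INR Q)) in *.
set (lo := IZR p / INR q - e); set (hi := IZR p / INR q + e).
assert (W : forall y n, lo <= y <= hi -> (K <= n)%nat ->
  (cos_sum y n)^2 + (sin_sum y n)^2 <= (B * INR n)^2).
{ intros y n Hy Hn.
  apply Rle_trans with (61 * harmonic (2 * q) * INR n ^ 2 / INR q).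
  - apply (weyl_inequality p); [lia|assumption|].
    apply Rle_trans with e; [unfold lo, hi in Hy; apply Rabs_le; lra|].
    unfold e; apply Rinv_le_contravar; nra.
  - replace ((B * INR n)^2) with (B * B * INR n ^ 2) by ring; rewrite BB.
    replace (64 * H / INR q * INR n ^ 2) with (64 * H * (INR n ^ 2 / INR q)) by (field; lra).
    replace (61 * harmonic (2 * q) * INR n ^ 2 / INR q)
      with (61 * harmonic (2 * q) * (INR n ^ 2 / INR q)) by (field; lra).
    apply Rmult_le_compat_r.
    + apply Rmult_le_pos; [apply pow2_ge_0|apply Rlt_le, Rinv_0_lt_compat; lra].
    + pose proof (harmonic_incr (2 * q) (2 * Q) ltac:(lia)); fold H in H0; lra. }
assert (SQ : forall u v c, 0 <= c -> u^2 + v^2 <= c^2 -> Rabs u <= c /\ Rabs v <= c).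
{ intros u v c Hc Huv.
  split; apply Rabs_le; split; nra. }
assert (BK : 1 <= B * INR K).
{ assert (BK2 : 1 <= (B * INR K) * (B * INR K)).
  { replace (B * INR K * (B * INR K)) with (B * B * (INR K * INR K)) by ring.
    rewrite BB; replace (64 * H / INR q * (INR K * INR K)) with
      (64 * (H * (INR K * (INR K / INR q)))) by (field; lra).
    assert (1 <= INR K / INR q).
    { apply Rmult_le_reg_r with (INR q); [lra|].
      replace (INR K / INR q * INR q) with (INR K) by (field; lra).
      rewrite Rmult_1_l; apply le_INR; lia. }
    assert (1 <= INR K * (INR K / INR q)) by nra.
    nra. }
  assert (0 <= B * INR K) by (apply Rmult_le_pos; [lra|apply pos_INR]).
  nra. }
assert (Hx : lo <= x <= hi) by (apply Rabs_le_inv in Ht; unfold lo, hi; lra).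
assert (Hx' : lo <= x' <= hi) by (apply Rabs_le_inv in Ht'; unfold lo, hi; lra).
(* With [K <= 2 w] and [|x - x'| <= 2 / w^2] the head costs [4 B / w]; the tail costs
   [B / K <= B / w]. *)
assert (D : B * (INR K * Rabs (x - x') + / INR K) <= 5 * B / w).
{ apply Rle_trans with (B * (2 * w * (2 * e) + / w)).
  - apply Rmult_le_compat_l; [assumption|].
    apply Rplus_le_compat; [|apply Rinv_le_contravar; lra].
    apply Rmult_le_compat; [lra|apply Rabs_pos|lra|].
    unfold lo, hi in *; apply Rabs_le; lra.
  - right; unfold e; rewrite <- ww; field; lra. }
replace (radius Q q) with (5 * B / w + 5 * B / w).
2: { unfold radius, B, w; fold H.
     assert (0 < INR Q) by lra.
     unfold Rdiv; rewrite !sqrt_mult, !sqrt_inv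
       by (try apply Rlt_le, Rinv_0_lt_compat; lra).
     assert (0 < sqrt (INR q)) by (apply sqrt_lt_R0; lra).
     assert (0 < sqrt (INR Q)) by (apply sqrt_lt_R0; lra).
     rewrite <- (sqrt_sqrt (INR q)) at 5 by lra.
     field; lra. }
apply dist2_le; eapply Rle_trans; try exact D.
- eapply Un_cv_dist_le with (K := K); [exact P1|exact P1'|].
  intros n Hn; rewrite !psum_rterm_re.
  apply (re_part_variation lo hi); auto; try lia.
  + intros y m Hy Hm; apply (SQ (cos_sum y m) (sin_sum y m));
      [apply Rmult_le_pos; [lra|apply pos_INR]|now apply W].
  + intros y m Hy Hm; apply (SQ (cos_sum y m) (sin_sum y m));
      [apply Rmult_le_pos; [lra|apply pos_INR]|now apply W].
- eapply Un_cv_dist_le with (K := K); [exact P2|exact P2'|].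
  intros n Hn; rewrite !psum_rterm_im.
  apply (im_part_variation lo hi); auto; try lia.
  + intros y m Hy Hm; apply (SQ (cos_sum y m) (sin_sum y m));
      [apply Rmult_le_pos; [lra|apply pos_INR]|now apply W].
  + intros y m Hy Hm; apply (SQ (cos_sum y m) (sin_sum y m));
      [apply Rmult_le_pos; [lra|apply pos_INR]|now apply W].
Qed.

(** * Covers and null sets *)

Lemma wpow_ge0 r s : 0 <= wpow r s.
Proof.
unfold wpow; destruct (Rle_dec r 0); [lra|].
apply Rlt_le, exp_pos.
Qed.

Lemma sum_f_R0_lsum f N : sum_f_R0 f N = lsum f (seq 0 (S N)).
Proof.
induction N as [|N IH]; [simpl; ring|].
now rewrite lsum_seq_S, <- IH.
Qed.

Lemma lsum_nth_error_le {I : Type} (f : I -> R) l N :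
  (forall i, In i l -> 0 <= f i) ->
  lsum (fun n => match nth_error l n with Some i => f i | None => 0 end) (seq 0 N)
  <= lsum f l.
Proof.
revert N; induction l as [|a l IH]; intros N Hf.
- rewrite (lsum_ext _ (fun _ => 0)) by (intros [|n] _; reflexivity).
  rewrite lsum_const; simpl; lra.
- destruct N as [|N]; [now apply lsum_ge0|].
  simpl seq; simpl lsum; rewrite <- seq_shift, lsum_map.
  apply Rplus_le_compat_l, IH; intros i Hi; apply Hf; now right.
Qed.

Lemma H_null_of_finite_covers s A :
  (forall delta eps, 0 < delta -> 0 < eps ->
    exists (I : Type) (l : list I) (U : I -> pt -> Prop) (r : I -> R),
      (forall x, A x -> exists i, In i l /\ U i x) /\
      (forall i, In i l -> 0 <= r i <= delta) /\
      (forall i x y, In i l -> U i x -> U i y -> dist2 x y <= r i) /\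
      lsum (fun i => wpow (r i) s) l <= eps) ->
  H_null s A.
Proof.
intros H delta eps Hd He.
destruct (H delta eps Hd He) as [I [l [U [r [Hc [Hr [Hdiam Hs]]]]]]].
(* Past the end of the list the sets are empty with radius 0, to which [wpow] gives weight 0 for
   every exponent. *)
exists (fun n x => match nth_error l n with Some i => U i x | None => False end).
exists (fun n => match nth_error l n with Some i => r i | None => 0 end).
split; [|split; [|split]].
- intros x Hx; destruct (Hc x Hx) as [i [Hi HU]].
  destruct (In_nth_error l i Hi) as [n Hn]; exists n; now rewrite Hn.
- intros n; destruct (nth_error l n) as [i|] eqn:E; [|lra].
  apply Hr, (nth_error_In _ _ E).
- intros n x y; destruct (nth_error l n) as [i|] eqn:E; [|easy].
  apply Hdiam, (nth_error_In _ _ E).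
- intros N; rewrite sum_f_R0_lsum.
  apply Rle_trans with (2 := Hs).
  rewrite (lsum_ext _ (fun n => match nth_error l n with
                                | Some i => wpow (r i) s | None => 0 end)).
  + apply lsum_nth_error_le; intros; apply wpow_ge0.
  + intros n _; destruct (nth_error l n); [reflexivity|].
    unfold wpow; destruct (Rle_dec 0 0); lra.
Qed.

Lemma geometric_lsum eps n : 0 <= eps ->
  lsum (fun m => eps * / 2 ^ S m) (seq 0 n) <= eps.
Proof.
intros He.
assert (E : lsum (fun m => eps * / 2 ^ S m) (seq 0 n) = eps * (1 - / 2 ^ n)).
{ induction n as [|n IH]; [simpl; field|].
  rewrite lsum_seq_S, IH; simpl; field; apply pow_nonzero; lra. }
rewrite E.
assert (0 < / 2 ^ n) by (apply Rinv_0_lt_compat, pow_lt; lra); nra.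
Qed.

Lemma H_null_countable_union s (A : nat -> pt -> Prop) :
  (forall m, H_null s (A m)) -> H_null s (fun x => exists m, A m x).
Proof.
intros H delta eps Hd He.
assert (Hm : forall m, exists Ur : (nat -> pt -> Prop) * (nat -> R),
  (forall x, A m x -> exists n, fst Ur n x) /\
  (forall n, 0 <= snd Ur n <= delta) /\
  (forall n x y, fst Ur n x -> fst Ur n y -> dist2 x y <= snd Ur n) /\
  (forall N, sum_f_R0 (fun n => wpow (snd Ur n) s) N <= eps * / 2 ^ S m)).
{ intros m.
  assert (0 < eps * / 2 ^ S m)
    by (apply Rmult_lt_0_compat; [lra|apply Rinv_0_lt_compat, pow_lt; lra]).
  destruct (H m delta (eps * / 2 ^ S m)) as [U [r Hr]]; auto.
  exists (U, r); exact Hr. }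
set (Ur := fun m => proj1_sig (constructive_indefinite_description _ (Hm m))).
assert (HU : forall m, (forall x, A m x -> exists n, fst (Ur m) n x) /\
  (forall n, 0 <= snd (Ur m) n <= delta) /\
  (forall n x y, fst (Ur m) n x -> fst (Ur m) n y -> dist2 x y <= snd (Ur m) n) /\
  (forall N, sum_f_R0 (fun n => wpow (snd (Ur m) n) s) N <= eps * / 2 ^ S m))
  by (intros m; exact (proj2_sig (constructive_indefinite_description _ (Hm m)))).
clearbody Ur; clear Hm.
exists (fun k => fst (Ur (fst (Cantor.of_nat k))) (snd (Cantor.of_nat k))).
exists (fun k => snd (Ur (fst (Cantor.of_nat k))) (snd (Cantor.of_nat k))).
split; [|split; [|split]].
- intros x [m Hx]; destruct (HU m) as [Hc _]; destruct (Hc x Hx) as [n Hn].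
  exists (Cantor.to_nat (m, n)); now rewrite Cantor.cancel_of_to.
- intros k; apply (HU (fst (Cantor.of_nat k))).
- intros k; apply (HU (fst (Cantor.of_nat k))).
- intros N; rewrite sum_f_R0_lsum.
  set (w := fun mn : nat * nat => wpow (snd (Ur (fst mn)) (snd mn)) s).
  change (lsum (fun k => w (Cantor.of_nat k)) (seq 0 (S N)) <= eps).
  rewrite <- lsum_map.
  (* The first [S N] Cantor codes decode to pairs with both coordinates at most [N], so the partial
     sum is dominated by the sum over a square, whose row [m] costs at most [eps / 2^(m+1)]. *)
  apply Rle_trans with
    (lsum w (flat_map (fun m => map (pair m) (seq 0 (S N))) (seq 0 (S N)))).
  + apply lsum_incl.
    * apply NoDup_map_inj_on; [apply seq_NoDup|].
      intros i j _ _ E.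
      rewrite <- (Cantor.cancel_to_of i), <- (Cantor.cancel_to_of j); congruence.
    * intros mn Hmn; apply in_map_iff in Hmn as [k [Ek Hk]]; apply in_seq in Hk.
      destruct mn as [m n].
      pose proof (Cantor.to_nat_non_decreasing m n) as Hmn.
      rewrite <- Ek, Cantor.cancel_to_of in Hmn.
      apply in_flat_map; exists m; split; [apply in_seq; lia|].
      apply in_map, in_seq; lia.
    * intros mn _; apply wpow_ge0.
  + rewrite lsum_flat_map.
    apply Rle_trans with (2 := geometric_lsum eps (S N) ltac:(lra)).
    apply lsum_le; intros m _; rewrite lsum_map; unfold w; simpl fst; simpl snd.
    rewrite <- sum_f_R0_lsum; apply (HU m).
Qed.

(** * Growth estimates *)

Lemma harmonic_le_ln n : (1 <= n)%nat -> harmonic n <= 1 + ln (INR n).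
Proof.
induction 1 as [|n Hn IH].
{ unfold harmonic; simpl; rewrite ln_1; lra. }
unfold harmonic in *; rewrite lsum_seq_S.
replace (1 + n)%nat with (S n) by lia.
assert (n0 : 0 < INR n) by (apply lt_0_INR; lia).
rewrite S_INR.
assert (L : ln (INR n / (INR n + 1)) <= - / (INR n + 1)).
{ set (z := INR n / (INR n + 1)).
  assert (0 < z) by (apply Rdiv_lt_0_compat; lra).
  pose proof (exp_ineq1_le (ln z)) as E; rewrite exp_ln in E by assumption.
  replace (- / (INR n + 1)) with (z - 1) by (unfold z; field; lra); lra. }
unfold Rdiv in L; rewrite ln_mult, ln_Rinv in L
  by (try apply Rinv_0_lt_compat; lra).
lra.
Qed.

Lemma Rpower_ge1 x e : 1 <= x -> 0 <= e -> 1 <= Rpower x e.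
Proof.
intros Hx He; rewrite <- (Rpower_O x) by lra; now apply Rle_Rpower.
Qed.

Lemma harmonic_le_power eta : 0 < eta ->
  exists C, 1 <= C /\
    forall Q, (1 <= Q)%nat -> harmonic (2 * Q) <= C * Rpower (INR Q) eta.
Proof.
intros He.
assert (0 < / eta) by now apply Rinv_0_lt_compat.
(* The 2 covers [1 + ln 2], and [1 / eta] comes from [eta * ln Q <= exp (eta * ln Q)]. *)
exists (2 + / eta); split; [lra|]; intros Q HQ.
assert (Q1 : 1 <= INR Q) by (change 1 with (INR 1); now apply le_INR).
pose proof (harmonic_le_ln (2 * Q) ltac:(lia)) as L.
rewrite mult_INR, ln_mult in L by (simpl; lra).
change (INR 2) with 2 in L.
assert (L2 : ln 2 <= 1).
{ pose proof (exp_ineq1_le (ln 2)) as E; rewrite exp_ln in E; lra. }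
pose proof (exp_ineq1_le (eta * ln (INR Q))) as E.
fold (Rpower (INR Q) eta) in E.
pose proof (Rpower_ge1 (INR Q) eta Q1 ltac:(lra)) as P.
assert (ln (INR Q) <= / eta * Rpower (INR Q) eta).
{ apply Rmult_le_reg_l with eta; [assumption|].
  rewrite <- Rmult_assoc, Rinv_r, Rmult_1_l by lra; lra. }
lra.
Qed.

Lemma Rpower_decay c e eps : 0 < c -> 0 < e -> 0 < eps ->
  exists Q0 : nat, forall Q, (Q0 <= Q)%nat -> (1 <= Q)%nat ->
    c * Rpower (INR Q) (- e) <= eps.
Proof.
intros Hc He Heps.
assert (0 < c / eps) by (apply Rdiv_lt_0_compat; lra).
set (z := Rpower (c / eps) (/ e)).
assert (z0 : 0 < z) by apply exp_pos.
destruct (INR_unbounded z) as [Q0 HQ0].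
exists Q0; intros Q HQ HQ1.
apply le_INR in HQ.
assert (P : c / eps <= Rpower (INR Q) e).
{ replace (c / eps) with (Rpower z e).
  - apply Rle_Rpower_l; lra.
  - unfold z; rewrite Rpower_mult, Rinv_l, Rpower_1; lra. }
rewrite Rpower_Ropp.
assert (0 < Rpower (INR Q) e) by apply exp_pos.
apply Rmult_le_reg_r with (Rpower (INR Q) e / eps); [apply Rdiv_lt_0_compat; lra|].
replace (c * / Rpower (INR Q) e * (Rpower (INR Q) e / eps)) with (c / eps) by (field; lra).
replace (eps * (Rpower (INR Q) e / eps)) with (Rpower (INR Q) e) by (field; lra).
exact P.
Qed.

(** * The upper bound *)

(** The factor [2 (M q + 1) + 1] counts the numerators [p] with [|p| <= M q + 1] and is at most
    [(2 M + 3) q]. Writing [q^(1 - s) = q^(2 - s) / q] and bounding [q^(2 - s)] by [Q^(2 - s)]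
    leaves a harmonic sum, one more harmless logarithm. *)
Lemma scaled_radius_sum (s : R) (M Q : nat) : 0 < s <= 2 -> (1 <= Q)%nat ->
  lsum (fun q => INR (2 * (M * q + 1) + 1) * wpow (radius Q q) s) (seq 1 Q)
  <= (2 * INR M + 3) * Rpower (80 * sqrt (harmonic (2 * Q) / INR Q)) s
     * Rpower (INR Q) (2 - s) * harmonic (2 * Q).
Proof.
intros Hs HQ.
assert (Q1 : 1 <= INR Q) by (change 1 with (INR 1); now apply le_INR).
pose proof (harmonic_ge1 (2 * Q) ltac:(lia)) as H1.
set (A := 80 * sqrt (harmonic (2 * Q) / INR Q)).
assert (A0 : 0 < A).
{ apply Rmult_lt_0_compat; [lra|].
  apply sqrt_lt_R0, Rdiv_lt_0_compat; lra. }
set (X := (2 * INR M + 3) * Rpower A s * Rpower (INR Q) (2 - s)).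
pose proof (pos_INR M) as M0.
assert (X0 : 0 <= X).
{ apply Rmult_le_pos; [apply Rmult_le_pos|]; [lra| |]; apply Rlt_le, exp_pos. }
apply Rle_trans with (X * harmonic Q).
2: { apply Rmult_le_compat_l; [assumption|apply harmonic_incr; lia]. }
unfold harmonic; rewrite <- lsum_scal.
apply lsum_le; intros q Hq; apply in_seq in Hq.
assert (q1 : 1 <= INR q) by (change 1 with (INR 1); apply le_INR; lia).
assert (qQ : INR q <= INR Q) by (apply le_INR; lia).
pose proof (radius_pos Q q HQ ltac:(lia)) as r0.
unfold wpow; destruct (Rle_dec (radius Q q) 0); [lra|].
assert (E : Rpower (radius Q q) s = Rpower A s * (Rpower (INR q) (2 - s) * / (INR q * INR q))).
{ unfold radius; fold A; unfold Rdiv.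
  rewrite <- Rpower_mult_distr by (try apply Rinv_0_lt_compat; lra).
  f_equal; unfold Rminus; rewrite Rpower_plus.
  replace (Rpower (INR q) 2) with (INR q * INR q).
  - replace (Rpower (/ INR q) s) with (Rpower (INR q) (- s)).
    + field; lra.
    + unfold Rpower; rewrite ln_Rinv by lra; f_equal; ring.
  - replace 2 with (1 + 1) by ring; rewrite Rpower_plus, Rpower_1; lra. }
rewrite E; unfold X.
apply Rle_trans with ((2 * INR M + 3) * INR q
  * (Rpower A s * (Rpower (INR Q) (2 - s) * / (INR q * INR q)))).
- apply Rmult_le_compat.
  + apply pos_INR.
  + apply Rmult_le_pos; [apply Rlt_le, exp_pos|].
    apply Rmult_le_pos; [apply Rlt_le, exp_pos|].
    apply Rlt_le, Rinv_0_lt_compat; nra.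
  + rewrite !plus_INR, !mult_INR, plus_INR, mult_INR; simpl; nra.
  + apply Rmult_le_compat_l; [apply Rlt_le, exp_pos|].
    apply Rmult_le_compat_r; [apply Rlt_le, Rinv_0_lt_compat; nra|].
    apply Rle_Rpower_l; lra.
- right; field; lra.
Qed.

Lemma sqrt_harmonic_le C eta Q : 1 <= C -> (1 <= Q)%nat ->
  harmonic (2 * Q) <= C * Rpower (INR Q) eta ->
  sqrt (harmonic (2 * Q) / INR Q) <= C * Rpower (INR Q) ((eta - 1) / 2).
Proof.
intros HC HQ HH.
assert (Q1 : 1 <= INR Q) by (change 1 with (INR 1); now apply le_INR).
set (z := Rpower (INR Q) ((eta - 1) / 2)).
assert (z0 : 0 < z) by apply exp_pos.
assert (zz : z * z = Rpower (INR Q) eta * / INR Q).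
{ unfold z; rewrite <- Rpower_plus.
  replace ((eta - 1) / 2 + (eta - 1) / 2) with (eta + Ropp 1) by field.
  now rewrite Rpower_plus, Rpower_Ropp, Rpower_1 by lra. }
rewrite <- (sqrt_Rsqr (C * z)) by nra.
apply sqrt_le_1_alt; unfold Rsqr.
replace (C * z * (C * z)) with (C * C * (z * z)) by ring; rewrite zz.
unfold Rdiv; rewrite <- Rmult_assoc.
apply Rmult_le_compat_r; [apply Rlt_le, Rinv_0_lt_compat; lra|].
apply Rle_trans with (1 := HH), Rmult_le_compat_r; [apply Rlt_le, exp_pos|nra].
Qed.

Lemma H_null_phi_bounded s M : 4 / 3 < s < 2 ->
  H_null s (fun P => exists t, Rabs (2 * PI * t) <= INR M /\ phi_val t P).
Proof.
intros Hs; apply H_null_of_finite_covers; intros delta eps Hd He.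
(* A quarter of the exponent gap [3s/2 - 2]. The harmonic factors cost [Q^(eta s/2)] through the
   radii and [Q^eta] through the sum over [q], in all less than [Q^(2 eta)], so [e2 = eta (3 - s/2)]
   stays positive. *)
set (eta := (3 / 2 * s - 2) / 4).
assert (eta0 : 0 < eta < / 4) by (unfold eta; lra).
destruct (harmonic_le_power eta) as [C [C1 HC]]; [lra|].
pose proof (pos_INR M) as M0.
set (c2 := (2 * INR M + 3) * Rpower (80 * C) s * C).
assert (c20 : 0 < c2).
{ apply Rmult_lt_0_compat; [apply Rmult_lt_0_compat|]; [lra|apply exp_pos|lra]. }
set (e2 := (1 - eta) / 2 * s - (2 - s) - eta).
assert (e20 : 0 < e2) by (unfold e2, eta; nra).
destruct (Rpower_decay (80 * C) ((1 - eta) / 2) delta) as [Q1 HQ1]; [lra|lra|lra|].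
destruct (Rpower_decay c2 e2 eps) as [Q2 HQ2]; [lra|lra|lra|].
set (Q := (Q1 + Q2 + 1)%nat).
assert (HQ : (1 <= Q)%nat) by (unfold Q; lia).
specialize (HQ1 Q ltac:(unfold Q; lia) HQ).
specialize (HQ2 Q ltac:(unfold Q; lia) HQ).
specialize (HC Q HQ).
clearbody Q.
assert (Q0 : 1 <= INR Q) by (change 1 with (INR 1); now apply le_INR).
pose proof (sqrt_harmonic_le C eta Q C1 HQ HC) as HS.
replace (- ((1 - eta) / 2)) with ((eta - 1) / 2) in HQ1 by field.
set (A := 80 * sqrt (harmonic (2 * Q) / INR Q)).
set (z := Rpower (INR Q) ((eta - 1) / 2)) in *.
assert (z0 : 0 < z) by apply exp_pos.
assert (HA : 0 < A <= 80 * C * z).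
{ split; [|unfold A; lra].
  apply Rmult_lt_0_compat; [lra|].
  pose proof (harmonic_ge1 (2 * Q) ltac:(lia)).
  apply sqrt_lt_R0, Rdiv_lt_0_compat; lra. }
(* From [|x| <= M] and [|x - p/q| <= 1/q] follows [|p| <= M q + 1], so these numerators suffice. *)
set (row := fun q => map (fun i => (q, (Z.of_nat i - Z.of_nat (M * q + 1))%Z))
                        (seq 0 (2 * (M * q + 1) + 1))).
exists (nat * Z)%type, (flat_map row (seq 1 Q)).
(* Coprimality is part of the covering set: a pair that is not coprime stays in the list with an
   empty set and merely enlarges the sum. *)
exists (fun i P => rel_prime (snd i) (Z.of_nat (fst i)) /\
  exists t, Rabs (2 * PI * t - IZR (snd i) / INR (fst i)) <= / (INR (fst i) * INR Q)
            /\ phi_val t P).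
exists (fun i => radius Q (fst i)).
assert (Hrow : forall i, In i (flat_map row (seq 1 Q)) -> (1 <= fst i <= Q)%nat).
{ intros i Hi; apply in_flat_map in Hi as [q [Hq Hi]]; apply in_seq in Hq.
  apply in_map_iff in Hi as [k [<- _]]; simpl; lia. }
split; [|split; [|split]].
- intros P [t [Ht HP]].
  destruct (dirichlet_approximation (2 * PI * t) Q HQ) as [p [q [Hq [Hpq Hx]]]].
  exists (q, p); split; [|simpl; eauto].
  assert (q1 : 1 <= INR q) by (change 1 with (INR 1); apply le_INR; lia).
  assert (Hp : (Z.abs p <= Z.of_nat (M * q + 1))%Z).
  { apply le_IZR; rewrite abs_IZR, <- INR_IZR_INZ, plus_INR, mult_INR; simpl.
    assert (E : Rabs (IZR p / INR q) <= INR M + / INR q).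
    { replace (IZR p / INR q) with (2 * PI * t - (2 * PI * t - IZR p / INR q)) by ring.
      eapply Rle_trans; [apply Rabs_triang|]; rewrite Rabs_Ropp.
      apply Rplus_le_compat; [assumption|].
      apply Rle_trans with (1 := Hx), Rinv_le_contravar; nra. }
    unfold Rdiv in E; rewrite Rabs_mult, (Rabs_pos_eq (/ _)) in E
      by (apply Rlt_le, Rinv_0_lt_compat; lra).
    apply Rmult_le_compat_r with (r := INR q) in E; [|lra].
    replace (Rabs (IZR p) * / INR q * INR q) with (Rabs (IZR p)) in E by (field; lra).
    replace ((INR M + / INR q) * INR q) with (INR M * INR q + 1) in E by (field; lra).
    exact E. }
  apply in_flat_map; exists q; split; [apply in_seq; lia|].
  apply in_map_iff; exists (Z.to_nat (p + Z.of_nat (M * q + 1))).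
  split; [f_equal; lia|apply in_seq; lia].
- intros i Hi; apply Hrow in Hi.
  assert (q1 : 1 <= INR (fst i)) by (change 1 with (INR 1); apply le_INR; lia).
  split; [apply Rlt_le, radius_pos; lia|].
  apply Rle_trans with A; [|lra].
  unfold radius; fold A.
  apply Rmult_le_reg_r with (INR (fst i)); [lra|].
  replace (A / INR (fst i) * INR (fst i)) with A by (field; lra); nra.
- intros i P P' Hi [Hpq [t [Ht HP]]] [_ [t' [Ht' HP']]].
  apply Hrow in Hi.
  now apply (phi_oscillation_near_rational (snd i) (fst i) Q t t').
- rewrite lsum_flat_map.
  rewrite (lsum_ext _ (fun q => INR (2 * (M * q + 1) + 1) * wpow (radius Q q) s)).
  2: { intros q _; unfold row; rewrite lsum_map; simpl fst.
       now rewrite lsum_const, length_seq. }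
  eapply Rle_trans; [apply scaled_radius_sum; [lra|assumption]|].
  fold A; apply Rle_trans with (2 := HQ2).
  apply Rle_trans with ((2 * INR M + 3) * (Rpower (80 * C) s * Rpower z s)
     * Rpower (INR Q) (2 - s) * (C * Rpower (INR Q) eta)).
  + pose proof (harmonic_ge0 (2 * Q)).
    assert (0 <= Rpower A s) by apply Rlt_le, exp_pos.
    assert (0 <= Rpower (INR Q) (2 - s)) by apply Rlt_le, exp_pos.
    apply Rmult_le_compat; [| |apply Rmult_le_compat_r|]; try assumption.
    * apply Rmult_le_pos; [apply Rmult_le_pos|]; lra.
    * apply Rmult_le_compat_l; [lra|].
      rewrite Rpower_mult_distr by lra.
      apply Rle_Rpower_l; lra.
  + right; unfold c2, z; rewrite Rpower_mult.
    replace (- e2) with ((eta - 1) / 2 * s + (2 - s) + eta) by (unfold e2; field).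
    rewrite !Rpower_plus; ring.
Qed.

Theorem H_null_phi_image s : 4 / 3 < s < 2 -> H_null s phi_image.
Proof.
intros Hs.
pose proof (H_null_countable_union s _ (fun M => H_null_phi_bounded s M Hs)) as H.
intros delta eps Hd He; destruct (H delta eps Hd He) as [U [r [Hc Hr]]].
exists U, r; split; [|exact Hr].
intros P [t Ht]; apply Hc.
destruct (INR_unbounded (Rabs (2 * PI * t))) as [M HM].
exists M, t; split; [lra|assumption].
Qed.

(** * The lower bound *)

(** As [PI^2 >= 9], each term is at most [1/m - 1/(m+1)], which telescopes. The bound 2 accommodates
    both [1 - cos] and [sin]. *)
Lemma inverse_square_tail (c : nat -> R) N n : (forall k, Rabs (c k) <= 2) ->
  Rabs (lsum (fun k => c k / (2 * PI^2 * (INR k)^2)) (seq (S N) n)) <= / INR (S N).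
Proof.
intros Hc; pose proof PI2_3_2 as P.
apply Rle_trans with (/ INR (S N) - / INR (S N + n)).
2: { assert (0 < / INR (S N + n)) by (apply Rinv_0_lt_compat, lt_0_INR; lia); lra. }
induction n as [|n IH].
{ rewrite Nat.add_0_r; simpl lsum; rewrite Rabs_R0; lra. }
rewrite lsum_seq_S.
eapply Rle_trans; [apply Rabs_triang|].
replace (S N + S n)%nat with (S (S N + n)) by lia.
set (m := (S N + n)%nat) in *.
assert (m1 : 1 <= INR m) by (change 1 with (INR 1); apply le_INR; unfold m; lia).
rewrite (S_INR m); set (u := INR m) in *.
assert (D : Rabs (c m / (2 * PI ^ 2 * u ^ 2)) <= / u - / (u + 1)); [|lra].
assert (Q : 0 < 2 * PI ^ 2 * u ^ 2)
  by (apply Rmult_lt_0_compat; [|apply pow_lt]; nra).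
unfold Rdiv; rewrite Rabs_mult, (Rabs_pos_eq (/ _)) by now apply Rlt_le, Rinv_0_lt_compat.
replace (/ u - / (u + 1)) with (2 * / (2 * u * (u + 1))) by (field; lra).
apply Rmult_le_compat; [apply Rabs_pos|now apply Rlt_le, Rinv_0_lt_compat|apply Hc|].
apply Rinv_le_contravar; [nra|].
assert (9 <= PI ^ 2) by nra.
assert (2 * 9 * u ^ 2 <= 2 * PI ^ 2 * u ^ 2) by (apply Rmult_le_compat_r; nra).
nra.
Qed.

Lemma re_part_tail x N n : Rabs (re_part x (N + n) - re_part x N) <= / INR (S N).
Proof.
unfold re_part; rewrite seq_app, lsum_app, Rplus_minus_l.
apply (inverse_square_tail (fun k => 1 - cos (2 * PI * (INR k)^2 * x))).
intros k; pose proof (COS_bound (2 * PI * (INR k)^2 * x)); apply Rabs_le; lra.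
Qed.

Lemma im_part_tail x N n : Rabs (im_part x (N + n) - im_part x N) <= / INR (S N).
Proof.
unfold im_part; rewrite seq_app, lsum_app, <- Rplus_assoc, Rplus_minus_l.
apply (inverse_square_tail (fun k => sin (2 * PI * (INR k)^2 * x))).
intros k; pose proof (SIN_bound (2 * PI * (INR k)^2 * x)); apply Rabs_le; lra.
Qed.

Lemma exists_inv_S_lt eps : 0 < eps -> exists N, / INR (S N) < eps.
Proof.
intros He; destruct (INR_unbounded (/ eps)) as [N HN]; exists N.
rewrite <- (Rinv_inv eps).
assert (0 < / eps) by now apply Rinv_0_lt_compat.
apply Rinv_lt_contravar; rewrite S_INR; [apply Rmult_lt_0_compat|]; lra.
Qed.

(** The rate is the same for every sequence, so for the family [re_part x] it means uniform
    convergence in [x], from which [phi_re] inherits continuity. *)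
Lemma Un_cv_of_tails (u : nat -> R) :
  (forall N n, Rabs (u (N + n)%nat - u N) <= / INR (S N)) ->
  { l : R | Un_cv u l /\ forall N, Rabs (l - u N) <= / INR (S N) }.
Proof.
intros H.
assert (Hc : Cauchy_crit u).
{ intros eps He.
  destruct (exists_inv_S_lt (eps / 2)) as [N HN]; [lra|].
  exists N; intros n m Hn Hm; unfold Rdist.
  pose proof (H N (n - N)%nat) as H1; pose proof (H N (m - N)%nat) as H2.
  replace (N + (n - N))%nat with n in H1 by lia.
  replace (N + (m - N))%nat with m in H2 by lia.
  apply Rabs_le_inv in H1, H2; apply Rabs_def1; lra. }
destruct (R_complete u Hc) as [l Hl]; exists l; split; [exact Hl|].
intros N; apply (Un_cv_dist_le u (fun _ => u N) l (u N) _ N).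
- exact Hl.
- intros eps He; exists 0%nat; intros n _; unfold Rdist.
  now rewrite Rminus_diag, Rabs_R0.
- intros n Hn; replace n with (N + (n - N))%nat by lia; apply H.
Qed.

Definition phi_re (x : R) : R :=
  proj1_sig (Un_cv_of_tails (re_part x) (re_part_tail x)).
Definition phi_im (x : R) : R :=
  proj1_sig (Un_cv_of_tails (im_part x) (im_part_tail x)).

Lemma phi_re_spec x :
  Un_cv (re_part x) (phi_re x) /\
  forall N, Rabs (phi_re x - re_part x N) <= / INR (S N).
Proof. exact (proj2_sig (Un_cv_of_tails (re_part x) (re_part_tail x))). Qed.

Lemma phi_im_spec x : Un_cv (im_part x) (phi_im x).
Proof. exact (proj1 (proj2_sig (Un_cv_of_tails (im_part x) (im_part_tail x)))). Qed.

Lemma Un_cv_eq (u v : nat -> R) l : (forall n, u n = v n) -> Un_cv u l -> Un_cv v l.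
Proof.
intros E H eps He; destruct (H eps He) as [N HN]; exists N.
intros n Hn; rewrite <- E; auto.
Qed.

Lemma phi_image_phi x : phi_image (phi_re x, phi_im x).
Proof.
pose proof PI_RGT_0.
assert (E : 2 * PI * (x / (2 * PI)) = x) by (field; lra).
exists (x / (2 * PI)); split; simpl.
- apply Un_cv_eq with (re_part x); [|apply phi_re_spec].
  intros n; now rewrite psum_rterm_re, E.
- apply Un_cv_eq with (im_part x); [|apply phi_im_spec].
  intros n; now rewrite psum_rterm_im, E.
Qed.

Lemma phi_re_continuous : continuity phi_re.
Proof.
intros x eps He.
destruct (exists_inv_S_lt (eps / 3)) as [N HN]; [lra|].
assert (C : continuity_pt (fun y => re_part y N) x).
{ apply derivable_continuous_pt; exists (sin_sum x (S N) / PI).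
  apply re_part_derive. }
destruct (C (eps / 3)) as [alp [Ha Hx]]; [lra|].
exists alp; split; [assumption|]; intros y Hy.
specialize (Hx y Hy).
change (Rabs (re_part y N - re_part x N) < eps / 3) in Hx.
change (Rabs (phi_re y - phi_re x) < eps).
destruct (phi_re_spec x) as [_ Tx]; specialize (Tx N).
destruct (phi_re_spec y) as [_ Ty]; specialize (Ty N).
apply Rabs_le_inv in Tx, Ty; apply Rabs_def2 in Hx; apply Rabs_def1; lra.
Qed.

Lemma phi_re_0 : phi_re 0 = 0.
Proof.
apply (UL_sequence (re_part 0)); [apply phi_re_spec|].
intros eps He; exists 0%nat; intros n _; unfold Rdist, re_part.
rewrite (lsum_ext _ (fun _ => 0)).
- rewrite lsum_const, Rmult_0_r, Rminus_diag, Rabs_R0; exact He.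
- intros k _; rewrite Rmult_0_r, cos_0; unfold Rdiv; ring.
Qed.

(** All terms of the real part are nonnegative, and at [x = 1/2] the term [k = 1] alone equals
    [1 / PI^2]. *)
Lemma phi_re_half_pos : 0 < phi_re (/ 2).
Proof.
pose proof PI_RGT_0 as P.
assert (P2 : 0 < / PI^2) by (apply Rinv_0_lt_compat, pow_lt; lra).
assert (B : forall N, / PI^2 <= re_part (/ 2) (S N)).
{ intros N; unfold re_part; simpl seq; simpl lsum.
  replace (2 * PI * (1 * (1 * 1)) * / 2) with PI by field.
  rewrite cos_PI.
  replace ((1 - -1) / (2 * (PI * (PI * 1)) * (1 * (1 * 1)))) with (/ PI^2) by (field; lra).
  match goal with |- _ <= _ + ?w => assert (0 <= w) end; [|lra].
  apply lsum_ge0; intros k Hk; apply in_seq in Hk.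
  assert (0 < INR k) by (apply lt_0_INR; lia).
  pose proof (COS_bound (2 * PI * (INR k * (INR k * 1)) * / 2)).
  apply Rmult_le_pos; [lra|].
  apply Rlt_le, Rinv_0_lt_compat.
  apply Rmult_lt_0_compat; nra. }
destruct (phi_re_spec (/ 2)) as [_ T].
destruct (exists_inv_S_lt (/ PI^2)) as [N HN]; [assumption|].
specialize (T (S N)); specialize (B N).
assert (/ INR (S (S N)) <= / INR (S N))
  by (apply Rinv_le_contravar; [apply lt_0_INR|apply le_INR]; lia).
apply Rabs_le_inv in T; lra.
Qed.

(* [overlap u l x] is the length of [(u - l, u + l)] to the left of [x]. *)
Definition overlap (u l x : R) : R := Rmax 0 (Rmin (2 * l) (x - (u - l))).

Lemma overlap_bounds u l x : 0 < l -> 0 <= overlap u l x <= 2 * l.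
Proof.
intros Hl; unfold overlap, Rmax, Rmin.
destruct (Rle_dec (2 * l) (x - (u - l))); destruct (Rle_dec 0 _); lra.
Qed.

Lemma overlap_incr u l x y : 0 < l -> x <= y -> overlap u l x <= overlap u l y.
Proof.
intros Hl Hxy; unfold overlap, Rmax, Rmin.
destruct (Rle_dec (2 * l) (x - (u - l))); destruct (Rle_dec (2 * l) (y - (u - l)));
  repeat destruct (Rle_dec 0 _); lra.
Qed.

Lemma overlap_inside u l x : Rabs (x - u) < l -> overlap u l x = x - (u - l).
Proof.
intros H; apply Rabs_def2 in H; unfold overlap, Rmax, Rmin.
destruct (Rle_dec (2 * l) (x - (u - l))); destruct (Rle_dec 0 _); lra.
Qed.

(* The set of [x] reached by the total overlap of finitely many intervals is
   open at its supremum, which replaces the appeal to compactness. *)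
Lemma interval_cover_length (c S : R) (u l : nat -> R) : 0 <= c ->
  (forall n, 0 < l n) ->
  (forall x, 0 <= x <= c -> exists n, Rabs (x - u n) < l n) ->
  (forall N, lsum l (seq 0 N) <= S) -> c <= 2 * S.
Proof.
intros Hc Hl Hcov HS.
set (G := fun N x => lsum (fun n => overlap (u n) (l n) x) (seq 0 N)).
set (E := fun x => 0 <= x <= c /\ exists N, x <= G N x).
assert (E0 : E 0) by (split; [lra|exists 0%nat; unfold G; simpl; lra]).
destruct (completeness E) as [e [Hub Hlub]].
{ exists c; intros x [Hx _]; lra. }
{ now exists 0. }
assert (He : 0 <= e <= c).
{ split; [now apply Hub|]. apply Hlub; intros x [Hx _]; lra. }
destruct (Hcov e He) as [n Hn].
set (d := l n - Rabs (e - u n)).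
assert (Hd : 0 < d) by (unfold d; lra).
assert (Hx : exists x, E x /\ e - d < x).
{ apply NNPP; intros HN.
  assert (e <= e - d); [|lra].
  apply Hlub; intros x Ex; apply Rnot_lt_le; intros L; apply HN; eauto. }
destruct Hx as [x [[Hx0 [N HNx]] Hxe]].
assert (x <= e) by (apply Hub; split; eauto).
set (y := Rmin c (e + d / 2)).
assert (Hy : e <= y <= e + d / 2) by (unfold y, Rmin; destruct (Rle_dec c (e + d / 2)); lra).
assert (Hyc : y <= c) by apply Rmin_l.
assert (In_n : forall z, e - d < z <= e + d / 2 -> Rabs (z - u n) < l n).
{ intros z Hz.
  replace (z - u n) with ((z - e) + (e - u n)) by ring.
  eapply Rle_lt_trans; [apply Rabs_triang|].
  assert (Rabs (z - e) < d) by (apply Rabs_def1; lra); unfold d in *; lra. }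
(* Both [x] and [y] lie in interval [n], whose overlap grows by exactly [y - x] while the others do
   not decrease. Hence [y] is in [E], so [y <= e < e + d/2], which forces [y = c]. *)
assert (Ey : E y).
{ split; [lra|].
  set (N' := (N + n + 1)%nat); exists N'.
  assert (G1 : G N x <= G N' x).
  { apply lsum_incl; [apply seq_NoDup| |intros; now apply overlap_bounds].
    intros i Hi; apply in_seq in Hi; apply in_seq; unfold N'; lia. }
  assert (G2 : y - x <= G N' y - G N' x); [|lra].
  replace (G N' y - G N' x) with
    (lsum (fun i => overlap (u i) (l i) y + -1 * overlap (u i) (l i) x) (seq 0 N'))
    by (rewrite lsum_plus, lsum_scal; unfold G; ring).
  apply Rle_trans with
    (lsum (fun i => overlap (u i) (l i) y + -1 * overlap (u i) (l i) x) [n]).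
  - simpl; rewrite !overlap_inside by (apply In_n; lra); lra.
  - apply lsum_incl.
    + constructor; [easy|constructor].
    + intros i [<-|[]]; apply in_seq; unfold N'; lia.
    + intros i _; pose proof (overlap_incr (u i) (l i) x y (Hl i) ltac:(lra)); lra. }
assert (y <= e) by now apply Hub.
assert (yc : y = c) by (unfold y, Rmin in *; destruct (Rle_dec c (e + d / 2)); lra).
destruct Ey as [_ [N' HN']]; rewrite yc in HN'.
apply Rle_trans with (1 := HN'), Rle_trans with (lsum (fun n => 2 * l n) (seq 0 N')).
- apply lsum_le; intros i _; now apply overlap_bounds.
- rewrite lsum_scal; specialize (HS N'); lra.
Qed.

Lemma le_wpow r s : 0 <= r <= 1 -> s <= 1 -> r <= wpow r s.
Proof.
intros Hr Hs; unfold wpow; destruct (Rle_dec r 0); [lra|].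
rewrite <- (Rpower_1 r) at 1 by lra.
pose proof (exp_ineq1_le (ln r)) as E; rewrite exp_ln in E by lra.
unfold Rpower; apply Rnot_lt_le; intros L; apply exp_lt_inv in L; nra.
Qed.

Lemma Rabs_fst_le_dist2 (P P' : pt) : Rabs (fst P - fst P') <= dist2 P P'.
Proof.
unfold dist2; rewrite <- sqrt_Rsqr_abs; apply sqrt_le_1_alt; unfold Rsqr.
pose proof (pow2_ge_0 (snd P - snd P')); nra.
Qed.

(** Projection to the first coordinate does not increase distances, so a cover of [A] yields
    intervals covering [[0, c]] with half-lengths comparable to the radii. *)
Lemma not_H_null_of_projection s (A : pt -> Prop) c : s <= 1 -> 0 < c ->
  (forall v, 0 <= v <= c -> exists P, A P /\ fst P = v) -> ~ H_null s A.
Proof.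
intros Hs Hc Hproj H.
(* [delta = 1] ensures [r n <= wpow (r n) s]. The radii and the padding added below sum to at most
   [c/8] each, so the total length is at most [c/2]. *)
destruct (H 1 (c / 8)) as [U [r [Hcov [Hr [Hdiam Hsum]]]]]; [lra|lra|].
set (u := fun n => fst (epsilon (inhabits (0, 0)) (U n))).
(* The padding makes the intervals open and of positive length even when [r n = 0]. Their centres
   are projections of chosen points of the [U n], arbitrary when [U n] is empty. *)
set (l := fun n => r n + c / 8 * / 2 ^ S n).
assert (Hp : forall n, 0 < c / 8 * / 2 ^ S n)
  by (intros n; apply Rmult_lt_0_compat; [lra|apply Rinv_0_lt_compat, pow_lt; lra]).
assert (c <= 2 * (c / 8 + c / 8)); [|lra].
apply (interval_cover_length c _ u l); [lra| | |].
- intros n; unfold l; specialize (Hr n); specialize (Hp n); lra.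
- intros v Hv; destruct (Hproj v Hv) as [P [HP <-]].
  destruct (Hcov P HP) as [n Hn]; exists n.
  apply Rle_lt_trans with (r n); [|unfold l; specialize (Hp n); lra].
  eapply Rle_trans; [apply Rabs_fst_le_dist2|].
  apply (Hdiam n); [exact Hn|].
  apply epsilon_spec; now exists P.
- intros N; unfold l; rewrite lsum_plus; apply Rplus_le_compat.
  + apply Rle_trans with (lsum (fun n => wpow (r n) s) (seq 0 (S N))).
    * apply Rle_trans with (lsum (fun n => wpow (r n) s) (seq 0 N)).
      -- apply lsum_le; intros n _; now apply le_wpow.
      -- rewrite lsum_seq_S; pose proof (wpow_ge0 (r (0 + N)%nat) s); lra.
    * rewrite <- sum_f_R0_lsum; apply Hsum.
  + apply geometric_lsum; lra.
Qed.

Theorem not_H_null_phi_image s : s <= 1 -> ~ H_null s phi_image.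
Proof.
intros Hs; apply (not_H_null_of_projection s _ (phi_re (/ 2)) Hs phi_re_half_pos).
intros v Hv.
destruct (IVT_cor (fun x => phi_re x - v) 0 (/ 2)) as [x [_ Hx]].
- apply (continuity_minus phi_re (fun _ => v)); [apply phi_re_continuous|].
  now apply continuity_const.
- lra.
- rewrite phi_re_0; nra.
- exists (phi_re x, phi_im x); split; [apply phi_image_phi|simpl; lra].
Qed.

(** * Existence of the dimension and conclusion *)

Lemma hausdorff_dim_exists (A : pt -> Prop) s0 : 0 <= s0 -> H_null s0 A ->
  exists d, is_hausdorff_dim A d.
Proof.
intros Hs0 H0.
set (E := fun x => 0 <= - x /\ H_null (- x) A).
destruct (completeness E) as [m [Hub Hlub]].
- exists 0; intros x [Hx _]; lra.
- exists (- s0); split; rewrite Ropp_involutive; assumption.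
- exists (- m); split.
  + intros s Hs H; assert (- s <= m); [|lra].
    apply Hub; split; rewrite Ropp_involutive; assumption.
  + intros b Hb; assert (m <= - b); [|lra].
    apply Hlub; intros x [Hx H]; specialize (Hb (- x) Hx H); lra.
Qed.

Theorem theorem1 :
  exists d : R, is_hausdorff_dim phi_image d /\ 1 <= d <= 4 / 3.
Proof.
destruct (hausdorff_dim_exists phi_image (5 / 3)) as [d Hd]; [lra| |].
{ apply H_null_phi_image; lra. }
exists d; split; [exact Hd|]; destruct Hd as [Hlb Hglb]; split.
- apply Hglb; intros s _ H; apply Rnot_lt_le; intros L.
  apply (not_H_null_phi_image s); [lra|exact H].
- apply le_epsilon; intros e He.
  (* The cap [1/3] keeps [s <= 5/3], inside the range [s < 2] of [H_null_phi_image]. *)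
  set (s := 4 / 3 + Rmin e (/ 3)).
  assert (0 < Rmin e (/ 3)) by (apply Rmin_glb_lt; lra).
  pose proof (Rmin_l e (/ 3)); pose proof (Rmin_r e (/ 3)).
  assert (d <= s); [|unfold s in *; lra].
  apply Hlb; [unfold s; lra|apply H_null_phi_image; unfold s; lra].
Qed.
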